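(* Let $\phi:X\to G$ be a measurable function and let $\pi$ be a finite-dimensional irreducible unitary representation of $G$ of dimension $d_\pi$. Assume that $$(\mathcal L_Y\phi)(x)=\frac{d}{dt}\Big|_{t=0}\phi\big(F_t(x)\big)\in T_{\phi(x)}G$$ exists for $\mu_X$-almost every $x\in X$ and that $M_\phi:=\mathcal L_Y\phi\cdot\phi^{-1}\in L^2(X,\mathfrak g)$. Then, for $\mu_X$-almost every $x\in X$, $$\lim_{N\to\infty}\left\|\frac1N\sum_{n=0}^{N-1}\big(W_{\pi\circ\phi}^nM_{\pi\circ\phi}\big)(x)-(d\pi)_{e_G}\big((P_\phi M_\phi)(x)\big)\right\|_{\mathscr B(\mathbb C^{d_\pi})}=0.$$
   Context: $X$ is a smooth compact second countable Hausdorff manifold with Borel probability measure $\mu_X$, and $\{F_t\}_{t\in\mathbb R}$ is a $C^1$ flow on $X$ preserving $\mu_X$, with continuous vector field $Y$; $\mathcal L_Yf(x)=\frac{d}{dt}|_{t=0}f(F_t(x))$. $G$ is a compact Lie group with identity $e_G$ and Lie algebra $\mathfrak g$, endowed with an $\mathrm{Ad}$-invariant scalar product $\langle\cdot,\cdot\rangle_{\mathfrak g}$, where $\mathrm{Ad}_gZ=gZg^{-1}$. $L^2(X,\mathfrak g)$ is the Hilbert space of measurable functions $X\to\mathfrak g$ with scalar product $\int_Xd\mu_X\langle f_1,f_2\rangle_{\mathfrak g}$. $M_\phi(x)=(\mathcal L_Y\phi)(x)\cdot\phi(x)^{-1}\in\mathfrak g$ is the right translate to $T_{e_G}G\simeq\mathfrak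 g$ of the tangent vector $(\mathcal L_Y\phi)(x)$. $W_\phi$ is the unitary operator in $L^2(X,\mathfrak g)$ given by $(W_\phi f)(x)=\mathrm{Ad}_{\phi(x)}f(F_1(x))$, and $P_\phi$ is the orthogonal projection onto $\ker(1-W_\phi)$. $\pi:G\to\mathrm U(d_\pi)$ is a $C^\infty$ homomorphism into unitary $d_\pi\times d_\pi$ matrices; $\mathfrak g_\pi$ is the Lie algebra of $\pi(G)$; $(d\pi)_{e_G}:\mathfrak g\to\mathfrak g_\pi$ is the differential of $\pi$ at $e_G$; $M_{\pi\circ\phi}:=\mathcal L_Y(\pi\circ\phi)\cdot(\pi\circ\phi)^{-1}$; $(W_{\pi\circ\phi}^nf)(x):=\mathrm{Ad}_{\pi(\phi^{(n)}(x))}f(F_n(x))$ for $f:X\to\mathfrak g_\pi$, where $\mathrm{Ad}_{u}Z=uZu^{-1}$, $\phi^{(0)}=e_G$ and $\phi^{(n)}(x)=\phi(x)\phi(F_1(x))\cdots\phi(F_{n-1}(x))$ for $n\ge1$. $\mathscr B(\mathbb C^{d_\pi})$ is the space of $d_\pi\times d_\pi$ complex matrices with operator norm. *)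

(* Defs.v *)
From HB Require Import structures.
From mathcomp Require Import all_boot all_order all_algebra.
From mathcomp Require Import complex.
From mathcomp Require Import all_classical all_reals all_analysis.

Set Implicit Arguments.
Unset Strict Implicit.
Unset Printing Implicit Defensive.

Import Order.TTheory GRing.Theory Num.Theory.
Import numFieldNormedType.Exports.

Local Open Scope classical_set_scope.
Local Open Scope ring_scope.

Notation borel T := (g_sigma_algebraType (@open T)).

(* A bare join of the algebraic and topological structures: that the group
   operations are smooth is part of lie_group below. *)
#[short(type="ptopGroupType")]
HB.structure Definition PTopGroup := { G of Group G & PointedTopological G }.

Section SmoothMaps.
Variables (R : realType) (V W : normedModType R).

(* In finite dimension the map x |-> 'd f x is C^k iff all the maps
   x |-> 'D_v f x are. *)
Fixpoint Ck_on (k : nat) (U : set V) (f : V -> W) : Prop :=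
  match k with
  | 0 => forall x, U x -> {for x, continuous f}
  | k'.+1 => (forall x, U x -> differentiable f x) /\
             (forall v, Ck_on k' U (fun x => 'D_v f x))
  end.

Definition smooth_on (U : set V) (f : V -> W) := forall k, Ck_on k U f.

End SmoothMaps.

(* A homeomorphism from the open set chart_dom onto the open subset
   chart @` chart_dom of R^n; chart_fun and chart_inv are irrelevant outside
   these sets. *)
Record chart (R : realType) (n : nat) (M : topologicalType) := Chart {
  chart_dom : set M;
  chart_fun :> M -> 'rV[R]_n;
  chart_inv : 'rV[R]_n -> M;
  chart_dom_open : open chart_dom;
  chart_img_open : open (chart_fun @` chart_dom);
  chart_funK : forall p, chart_dom p -> chart_inv (chart_fun p) = p;
  chart_continuous : forall p, chart_dom p -> {for p, continuous chart_fun};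
  chart_inv_continuous : forall u, (chart_fun @` chart_dom) u ->
    {for u, continuous chart_inv} }.

(* The preferred chart chart_at p identifies the tangent space at p with R^n:
   throughout, a tangent vector at p is given by its coordinates in chart_at p. *)
Record smooth_structure (R : realType) (n : nat) (M : topologicalType) :=
  SmoothStructure {
    atlas : set (chart R n M);
    chart_at : M -> chart R n M;
    chart_at_atlas : forall p, atlas (chart_at p);
    chart_at_dom : forall p, chart_dom (chart_at p) p;
    atlas_compatible : forall c c' : chart R n M, atlas c -> atlas c' ->
      smooth_on (c @` (chart_dom c `&` chart_dom c')) (c' \o chart_inv c) }.

Definition compact_manifold_topology (M : topologicalType) : Prop :=
  [/\ compact [set: M], @second_countable M & hausdorff_space M].

Section Manifolds.
Variables (R : realType) (n : nat) (M : topologicalType).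
Variable sM : smooth_structure R n M.

Definition smooth_map (n' : nat) (N : topologicalType)
    (sN : smooth_structure R n' N) (f : M -> N) : Prop :=
  continuous f /\
  forall (c : chart R n M) (c' : chart R n' N), atlas sM c -> atlas sN c' ->
    smooth_on (c @` (chart_dom c `&` f @^-1` chart_dom c'))
              (c' \o f \o chart_inv c).

(* Smoothness on the product manifold M x M, in product charts. *)
Definition smooth_map2 (n' : nat) (N : topologicalType)
    (sN : smooth_structure R n' N) (f : M -> M -> N) : Prop :=
  continuous (fun p : M * M => f p.1 p.2) /\
  forall (a b : chart R n M) (c : chart R n' N),
    atlas sM a -> atlas sM b -> atlas sN c ->
    smooth_on [set (a p.1, b p.2) | p in
                [set p : M * M | [/\ chart_dom a p.1, chart_dom b p.2
                                   & chart_dom c (f p.1 p.2)]]]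
      (fun u : 'rV[R]_n * 'rV[R]_n =>
         c (f (chart_inv a u.1) (chart_inv b u.2))).

(* The tangent map T_pM -> T_(f p)N. *)
Definition mdiff (n' : nat) (N : topologicalType)
    (sN : smooth_structure R n' N) (f : M -> N) (p : M) (v : 'rV[R]_n) :
    'rV[R]_n' :=
  'D_v (chart_at sN (f p) \o f \o chart_inv (chart_at sM p)) (chart_at sM p p).

Definition has_velocity (gamma : R -> M) (t : R) : Prop :=
  {for t, continuous gamma} /\ derivable (chart_at sM (gamma t) \o gamma) t 1.

Definition velocity (gamma : R -> M) (t : R) : 'rV[R]_n :=
  'D_1 (chart_at sM (gamma t) \o gamma) t.

(* F t x stands for F_t(x); C^1 is meant jointly in (t, x). The last clause
   is the continuity of the vector field Y(x) = d/dt|_{t=0} F_t(x), read in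
   the charts of the atlas. *)
Definition C1_flow (F : R -> M -> M) : Prop :=
  [/\ forall x, F 0 x = x,
      forall s t x, F (s + t) x = F s (F t x),
      continuous (fun q : R * M => F q.1 q.2),
      forall a b : chart R n M, atlas sM a -> atlas sM b ->
        Ck_on 1 [set (q.1, a q.2) | q in
                  [set q : R * M | chart_dom a q.2 /\ chart_dom b (F q.1 q.2)]]
          (fun u : R * 'rV[R]_n => b (F u.1 (chart_inv a u.2)))
    & forall c : chart R n M, atlas sM c -> forall x, chart_dom c x ->
        {for x, continuous (fun y => 'D_1 (fun t => c (F t y)) 0)} ].

End Manifolds.

Section MatrixFunctions.
Variables (R : realType) (V : normedModType R) (d : nat).
Implicit Types f : V -> 'M[R[i]]_d.

Definition re_mx (A : 'M[R[i]]_d) : 'M[R]_d := map_mx (@complex.Re R) A.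
Definition im_mx (A : 'M[R[i]]_d) : 'M[R]_d := map_mx (@complex.Im R) A.

(* Real directional derivative of a complex matrix-valued function. *)
Definition mx_derive f (x v : V) : 'M[R[i]]_d :=
  \matrix_(i, j) Complex ('D_v (re_mx \o f) x i j) ('D_v (im_mx \o f) x i j).

Definition mx_smooth_on (U : set V) f : Prop :=
  smooth_on U (re_mx \o f) /\ smooth_on U (im_mx \o f).

End MatrixFunctions.

Section OperatorNorm.
Variables (R : realType) (d : nat).

Definition l2norm (v : 'cV[R[i]]_d) : R :=
  Num.sqrt (\sum_(i < d) (complex.Re (v i 0) ^+ 2 + complex.Im (v i 0) ^+ 2)).

Definition opnorm (A : 'M[R[i]]_d) : R :=
  sup [set l2norm (A *m v) | v in [set v : 'cV[R[i]]_d | l2norm v <= 1]].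

End OperatorNorm.

Section LieGroup.
Variables (R : realType) (n : nat) (G : ptopGroupType).
Variable sG : smooth_structure R n G.

Definition lie_group : Prop :=
  smooth_map2 sG sG (fun g h => (g * h)%g) /\ smooth_map sG sG (fun g => g^-1%g).

(* The Lie algebra is T_e G, that is 'rV[R]_n, since g * e * g^-1 = e. *)
Definition Ad (g : G) (Z : 'rV[R]_n) : 'rV[R]_n :=
  mdiff sG sG (fun h => (g * h * g^-1)%g) 1%g Z.

(* The right translate v . g^-1 in T_e G of v in T_g G. *)
Definition right_translate (g : G) (v : 'rV[R]_n) : 'rV[R]_n :=
  mdiff sG sG (fun h => (h * g^-1)%g) g v.

Definition Ad_invariant_scalar_product
    (ip : 'rV[R]_n -> 'rV[R]_n -> R) : Prop :=
  [/\ forall v, scalar (ip^~ v),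
      forall u v, ip u v = ip v u,
      forall u, u != 0 -> 0 < ip u u
    & forall g u v, ip (Ad g u) (Ad g v) = ip u v].

Section Representation.
Variables (d : nat) (pi : G -> 'M[R[i]]_d).

Definition smooth_unitary_representation : Prop :=
  [/\ pi 1%g = 1%:M,
      forall g h, pi (g * h)%g = pi g *m pi h,
      forall g, pi g \is unitarymx
    & forall c : chart R n G, atlas sG c ->
        mx_smooth_on (c @` chart_dom c) (pi \o chart_inv c)].

(* pi g acts on column vectors, whereas stablemx is about row spaces: hence
   the transpose. *)
Definition irreducible_representation : Prop :=
  (0 < d)%N /\
  forall U : 'M[R[i]]_d, (forall g, stablemx U (pi g)^T) ->
    \rank U = 0%N \/ \rank U = d.

(* (d pi)_e : T_e G -> M_d(C). *)
Definition rep_diff (Z : 'rV[R]_n) : 'M[R[i]]_d :=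
  mx_derive (pi \o chart_inv (chart_at sG 1%g)) (chart_at sG 1%g 1%g) Z.

End Representation.

Section Cocycle.
Variables (X : ptopologicalType) (mu : probability (borel X) R).
Variables (F : R -> X -> X) (phi : X -> G) (ip : 'rV[R]_n -> 'rV[R]_n -> R).
Implicit Types f h p : X -> 'rV[R]_n.

Definition ae_eq_fun f h : Prop := {ae mu, forall x, f x = h x}.

(* L^2(X, g): elements are such functions up to ae_eq_fun. *)
Definition L2 f : Prop :=
  measurable_fun [set: borel X] (f : borel X -> borel 'rV[R]_n) /\
  (\int[mu]_x (ip (f x) (f x))%:E < +oo)%E.

Definition L2dot f h : R := \int[mu]_x ip (f x) (h x).

(* Functions which are only defined almost everywhere (such as M_phi) belong
   to L^2 through a measurable representative. *)
Definition L2_representative f : set (X -> 'rV[R]_n) :=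
  [set f' | L2 f' /\ ae_eq_fun f f'].

Definition in_L2 f : Prop := exists f', L2_representative f f'.

Definition W_op f : X -> 'rV[R]_n := fun x => Ad (phi x) (f (F 1 x)).

Definition ker_1_sub_W : set (X -> 'rV[R]_n) :=
  [set p | L2 p /\ ae_eq_fun (W_op p) p].

(* p is (a representative of) the orthogonal projection of f on ker(1 - W). *)
Definition is_projection f p : Prop :=
  ker_1_sub_W p /\
  exists2 f', L2_representative f f' &
    forall h, ker_1_sub_W h -> L2dot (fun x => f' x - p x) h = 0.

(* For f in L^2 the projection exists (ker_1_sub_W is a closed subspace) and is
   unique almost everywhere, so the default value of xget is irrelevant. *)
Definition P_op f : X -> 'rV[R]_n := xget (fun=> 0) [set p | is_projection f p].

Definition M_phi : X -> 'rV[R]_n :=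
  fun x => right_translate (phi x) (velocity sG (fun t => phi (F t x)) 0).

(* phi^(k)(x) = phi(x) phi(F_1 x) ... phi(F_(k-1) x). *)
Definition cocycle (k : nat) (x : X) : G :=
  (\prod_(0 <= j < k) phi (F j%:R x))%g.

Section Induced.
Variables (d : nat) (pi : G -> 'M[R[i]]_d).

Definition M_pi_phi : X -> 'M[R[i]]_d := fun x =>
  mx_derive (fun t : R => pi (phi (F t x))) 0 1 *m invmx (pi (phi x)).

Definition W_pi_phi (k : nat) (f : X -> 'M[R[i]]_d) : X -> 'M[R[i]]_d :=
  fun x => pi (cocycle k x) *m f (F k%:R x) *m invmx (pi (cocycle k x)).

End Induced.
End Cocycle.
End LieGroup.

(* Main.v *)
Require Import Defs.
From HB Require Import structures.
From mathcomp Require Import all_boot all_order all_algebra.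
From mathcomp Require Import complex.
From mathcomp Require Import all_classical all_reals all_analysis.
From mathcomp Require Import measurable_realfun.
From mathcomp Require Import ring lra.

(** The statement is a pointwise ergodic theorem for the isometry
    [(W f) x = Ad (phi x) (f (F_1 x))] of the Lie-algebra-valued functions, read
    through the linear map [rep_diff] (the differential of [pi]).

    Reduction. Differentiating [pi (g h g^-1) = pi g pi h pi g^-1] at [h = 1]
    shows that [rep_diff] intertwines [Ad g] with conjugation by [pi g]
    ([rep_diff_Ad]), and differentiating [pi (phi (F_t x) phi(x)^-1)] at [t = 0]
    shows that [M_pi_phi = rep_diff M_phi] wherever [phi] has a velocity
    ([mx_derive_right_translate]). As the flow preserves null sets, for almost
    every [x] this holds along the whole orbit [F_k x], and the matrix in the
    statement is [rep_diff] applied to the [N]-th average of [W^k M_phi] at [x]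
    minus the projection ([average_W_pi_phiE]). Since [rep_diff] is linear on a
    space of finite dimension, it remains to prove that the averages converge
    almost everywhere, coordinate by coordinate ([averages_cvg_projection]).

    Pointwise ergodic theorem. Because [W] combines a measure-preserving map
    with fibrewise linear isometries, [|W^k f|^2 x = |f|^2 (F_k x)], so that
    scalar inequalities along orbits control the vector-valued averages. An
    element of nearly minimal norm in the convex hull of the [W^k f] differs from
    [f] by a coboundary [g - W g], and minimizing sequences converge, almost
    everywhere and in the mean, to a fixed vector [v] ([mean_ergodic]). Thus
    [f = v + (g - W g) + r] with [r] small in the mean. The averages of [v] are
    [v]; those of [g - W g] telescope to [(g - W^N g) / N], which tends to [0]
    almost everywhere; those of [r] are small outside a set of small measure by
    the maximal ergodic inequality applied to [|r|^2]
    ([maximal_ergodic_inequality]). Hence the averages of [f] converge to [v]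
    almost everywhere ([pointwise_ergodic]). Coboundaries are orthogonal to fixed
    vectors, so [v] is the orthogonal projection of [f]: this gives at once the
    existence of the projection and its equality with the limit.

    For [W f] to be measurable one needs [g |-> Ad g Z] to be Borel; it is a
    pointwise limit of difference quotients that depend continuously on [g]
    ([Ad_measurable]). *)

Import Order.TTheory GRing.Theory Num.Theory.
Import numFieldNormedType.Exports.

Set Implicit Arguments.
Unset Strict Implicit.
Unset Printing Implicit Defensive.

Local Open Scope classical_set_scope.
Local Open Scope ring_scope.

(** * Differentiation through charts *)

Lemma near_eq_differentiable (R : numFieldType) (V W : normedModType R)
    (f g : V -> W) (a : V) :
  (\near a, f a = g a) -> differentiable f a -> differentiable g a.
Proof.
move=> fg df.
have dgE : g \o shift a = cst (g a) + 'd f a +o_ 0 id.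
  have /eqaddoP fo := diff_locally df.
  apply/eqaddoP => e e0.
  have fg0 : \forall h \near (0 : V), f (h + a) = g (h + a).
    by have := fg; rewrite (near_shift 0); apply: filterS => h /=; rewrite subr0.
  have := fo e e0; apply: filter_app; move: fg0; apply: filterS => h fgh.
  by rewrite /= !fctE /= !fgh (nbhs_singleton fg).
have dgf : 'd g a = 'd f a :> (V -> W).
  by apply: diff_unique => //; exact: diff_continuous.
by apply/diff_locallyP; rewrite dgf; split=> //; exact: diff_continuous.
Qed.

(** A directional derivative is a limit along a sequence; this is what makes it a
    measurable function of a parameter. *)
Lemma derive_cvg_harmonic (R : realType) (V W : normedModType R) (f : V -> W) a v :
  derivable f a v ->
  (fun N => N.+1%:R *: (f (N.+1%:R^-1 *: v + a) - f a)) @ \oo --> 'D_v f a.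
Proof.
move=> df.
have h0 : @harmonic R @ \oo --> (0 : R)^'.
  move=> A A0; have {}A0 : nbhs (0 : R) (fun x => x != 0 -> A x) by exact: A0.
  have : \forall N \near \oo, (harmonic N : R) != 0 -> A (harmonic N).
    exact: cvg_harmonic A0.
  have N0 N : (N.+1%:R^-1 : R) != 0 by rewrite invr_eq0 pnatr_eq0.
  by apply: filterS => N hN; apply: hN; exact: (N0 N).
have -> : (fun N => N.+1%:R *: (f (N.+1%:R^-1 *: v + a) - f a)) =
    (fun h => h^-1 *: ((f \o shift a) (h *: v) - f a)) \o @harmonic R.
  by apply/funext => N /=; rewrite /harmonic/= invrK.
exact: (cvg_comp _ _ h0 df).
Qed.

Section ThroughChart.
Variables (R : realType) (n : nat) (M : topologicalType).
Variable sM : smooth_structure R n M.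

Lemma near_chart (V : topologicalType) (gam : V -> M) (a : V) :
  {for a, continuous gam} ->
  \forall u \near a, chart_inv (chart_at sM (gam a)) (chart_at sM (gam a) (gam u)) = gam u.
Proof.
move=> cg; have : \forall u \near a, chart_dom (chart_at sM (gam a)) (gam u).
  apply: cg; apply: open_nbhs_nbhs; split; first exact: chart_dom_open.
  exact: chart_at_dom.
by apply: filterS => u; exact: chart_funK.
Qed.

(** A vector-valued function of a curve or map [gam] into a manifold is handled
    by inserting the preferred chart at [gam a]: near [a], where [gam] stays in
    its domain by continuity, [Q \o gam] is the composite of [c \o gam] and
    [Q \o c^-1], two maps between normed spaces to which the chain rule
    applies. All the chain rules below are instances. *)
Section Core.
Variables (V W : normedModType R) (gam : V -> M) (Q : M -> W) (a : V).
Let c := chart_at sM (gam a).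
Hypotheses (cgam : {for a, continuous gam}) (dgam : differentiable (c \o gam) a).
Hypothesis dQ : differentiable (Q \o chart_inv c) (c (gam a)).

Let QgamE : \near a, ((Q \o chart_inv c) \o (c \o gam)) a = (Q \o gam) a.
Proof. by have := near_chart cgam; apply: filterS => u /= ->. Qed.

Lemma differentiable_through_chart : differentiable (Q \o gam) a.
Proof. by apply: (near_eq_differentiable QgamE); exact: differentiable_comp. Qed.

Lemma derive_through_chart v :
  'D_v (Q \o gam) a = 'D_('D_v (c \o gam) a) (Q \o chart_inv c) (c (gam a)).
Proof.
rewrite -(near_eq_derive _ QgamE) deriveE; last exact: differentiable_comp.
by rewrite diff_comp//= -deriveE// -deriveE.
Qed.

End Core.
End ThroughChart.

(** * Chain rules on manifolds and the adjoint action *)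

Section DifferentiableMaps.
Variable R : realType.

(** Continuity is not implied by the second clause: the chart expression only
    describes [f] where [f] lands in the domain of the chart at [f p]. *)
Definition mdifferentiable n (M : topologicalType) (sM : smooth_structure R n M)
    n' (N : topologicalType) (sN : smooth_structure R n' N) (f : M -> N) (p : M) :=
  {for p, continuous f} /\
  differentiable (chart_at sN (f p) \o f \o chart_inv (chart_at sM p))
                 (chart_at sM p p).

Section OneMap.
Variables (n : nat) (M : topologicalType) (sM : smooth_structure R n M).
Variables (n' : nat) (N : topologicalType) (sN : smooth_structure R n' N).

Lemma chart_at_img p : (chart_at sM p @` chart_dom (chart_at sM p)) (chart_at sM p p).
Proof. by exists p => //; exact: chart_at_dom. Qed.

Lemma chart_atK p : chart_inv (chart_at sM p) (chart_at sM p p) = p.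
Proof. by apply: chart_funK; exact: chart_at_dom. Qed.

Lemma continuous_chart_inv (T : topologicalType) (f : M -> T) p :
  {for p, continuous f} ->
  {for chart_at sM p p, continuous (f \o chart_inv (chart_at sM p))}.
Proof.
move=> cf; apply: continuous_comp.
  by apply: chart_inv_continuous; exact: chart_at_img.
by rewrite chart_atK.
Qed.

Lemma mdiff_linear (f : M -> N) p : mdifferentiable sM sN f p ->
  linear (mdiff sM sN f p).
Proof. by move=> [_ df] a u v; rewrite /mdiff !deriveE// linearP. Qed.

Lemma derive_mdiff (W : normedModType R) (f : M -> N) (Q : N -> W) p v :
  mdifferentiable sM sN f p ->
  differentiable (Q \o chart_inv (chart_at sN (f p))) (chart_at sN (f p) (f p)) ->
  'D_v (Q \o f \o chart_inv (chart_at sM p)) (chart_at sM p p) =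
  'D_(mdiff sM sN f p v) (Q \o chart_inv (chart_at sN (f p))) (chart_at sN (f p) (f p)).
Proof.
move=> [cf df] dQ; have cg := continuous_chart_inv cf.
have := @derive_through_chart R n' N sN _ W (f \o chart_inv (chart_at sM p)) Q.
move/(_ (chart_at sM p p) cg); rewrite /= chart_atK => /(_ df dQ v).
by [].
Qed.

Lemma differentiable_mdiff (W : normedModType R) (f : M -> N) (Q : N -> W) p :
  mdifferentiable sM sN f p ->
  differentiable (Q \o chart_inv (chart_at sN (f p))) (chart_at sN (f p) (f p)) ->
  differentiable (Q \o f \o chart_inv (chart_at sM p)) (chart_at sM p p).
Proof.
move=> [cf df] dQ; have cg := continuous_chart_inv cf.
have := @differentiable_through_chart R n' N sN _ W (f \o chart_inv (chart_at sM p)) Q.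
by move/(_ (chart_at sM p p) cg); rewrite /= chart_atK => /(_ df dQ).
Qed.

End OneMap.

Section Composition.
Variables (n : nat) (M : topologicalType) (sM : smooth_structure R n M).
Variables (n' : nat) (N : topologicalType) (sN : smooth_structure R n' N).
Variables (n'' : nat) (P : topologicalType) (sP : smooth_structure R n'' P).
Variables (f : M -> N) (g : N -> P) (p : M).
Hypotheses (df : mdifferentiable sM sN f p) (dg : mdifferentiable sN sP g (f p)).

Lemma mdifferentiable_comp : mdifferentiable sM sP (g \o f) p.
Proof.
split; first by apply: continuous_comp; [case: df | case: dg].
by case: dg => _ dg2; exact: (differentiable_mdiff df dg2).
Qed.

Lemma mdiff_comp v :
  mdiff sM sP (g \o f) p v = mdiff sN sP g (f p) (mdiff sM sN f p v).
Proof. by case: dg => _ dg2; exact: (derive_mdiff _ df dg2). Qed.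

End Composition.

Section Curves.
Variables (n : nat) (M : topologicalType) (sM : smooth_structure R n M).
Variables (n' : nat) (N : topologicalType) (sN : smooth_structure R n' N).
Variables (gam : R -> M) (t : R).
Hypothesis vgam : has_velocity sM gam t.

Lemma derive_velocity (W : normedModType R) (Q : M -> W) :
  differentiable (Q \o chart_inv (chart_at sM (gam t))) (chart_at sM (gam t) (gam t)) ->
  'D_1 (Q \o gam) t =
  'D_(velocity sM gam t) (Q \o chart_inv (chart_at sM (gam t))) (chart_at sM (gam t) (gam t)).
Proof.
case: vgam => cg /derivable1_diffP dg dQ; exact: (derive_through_chart cg dg dQ).
Qed.

Lemma derivable_velocity (W : normedModType R) (Q : M -> W) :
  differentiable (Q \o chart_inv (chart_at sM (gam t))) (chart_at sM (gam t) (gam t)) ->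
  derivable (Q \o gam) t 1.
Proof.
case: vgam => cg /derivable1_diffP dg dQ; apply/derivable1_diffP.
exact: (differentiable_through_chart cg dg dQ).
Qed.

Lemma has_velocity_comp (f : M -> N) : mdifferentiable sM sN f (gam t) ->
  has_velocity sN (f \o gam) t.
Proof.
case=> cf df; split; first by apply: continuous_comp => //; case: vgam.
exact: (derivable_velocity df).
Qed.

Lemma velocity_comp (f : M -> N) : mdifferentiable sM sN f (gam t) ->
  velocity sN (f \o gam) t = mdiff sM sN f (gam t) (velocity sM gam t).
Proof. by case=> cf df; exact: (derive_velocity df). Qed.

End Curves.
End DifferentiableMaps.

Section LieGroups.
Variables (R : realType) (n : nat) (G : ptopGroupType).
Variables (sG : smooth_structure R n G) (hLie : lie_group sG).
Local Notation L g := (fun h : G => (g * h)%g).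
Local Notation Rt g := (fun h : G => (h * g)%g).

Let mulD (g h : G) : differentiable (fun u : 'rV[R]_n * 'rV[R]_n =>
    chart_at sG (g * h)%g (chart_inv (chart_at sG g) u.1 * chart_inv (chart_at sG h) u.2)%g)
  (chart_at sG g g, chart_at sG h h).
Proof.
case: hLie => -[_ /(_ (chart_at sG g) (chart_at sG h) (chart_at sG (g * h)%g))] + _.
move=> /(_ (chart_at_atlas _ _) (chart_at_atlas _ _) (chart_at_atlas _ _) 1%N)[+ _].
apply; exists (g, h) => //=; split; exact: chart_at_dom.
Qed.

Lemma mulg_continuous : continuous (fun p : G * G => (p.1 * p.2)%g).
Proof. by case: hLie => -[]. Qed.

Lemma invg_continuous : continuous (fun g : G => g^-1%g).
Proof. by case: hLie => _ []. Qed.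

Lemma mulgl_continuous g : continuous (L g).
Proof.
move=> h; have := @mulg_continuous (g, h).
apply: (@continuous_comp _ _ _ (fun h => (g, h)) (fun p : G * G => p.1 * p.2)%g).
by apply: cvg_pair => /=; [exact: cvg_cst | exact: cvg_id].
Qed.

Lemma mulgr_continuous g : continuous (Rt g).
Proof.
move=> h; have := @mulg_continuous (h, g).
apply: (@continuous_comp _ _ _ (fun h => (h, g)) (fun p : G * G => p.1 * p.2)%g).
by apply: cvg_pair => /=; [exact: cvg_id | exact: cvg_cst].
Qed.

(** Translations are slices of the multiplication, which is smooth on the
    product: fix the first coordinate of the chart expression of the product. *)
Lemma mdifferentiable_mulgl g h : mdifferentiable sG sG (L g) h.
Proof.
split; first exact: mulgl_continuous.
have /= := @differentiable_comp R _ _ _ (fun v : 'rV[R]_n => (chart_at sG g g, v)) _ (chart_at sG h h) _ (mulD g h).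
rewrite /comp /= chart_atK; apply.
exact: differentiable_pair.
Qed.

Lemma mdifferentiable_mulgr g h : mdifferentiable sG sG (Rt g) h.
Proof.
split; first exact: mulgr_continuous.
have /= := @differentiable_comp R _ _ _ (fun v : 'rV[R]_n => (v, chart_at sG g g)) _ (chart_at sG h h) _ (mulD h g).
rewrite /comp /= chart_atK; apply.
exact: differentiable_pair.
Qed.

Lemma mdifferentiable_conj g h : mdifferentiable sG sG (fun h => g * h * g^-1)%g h.
Proof.
have := mdifferentiable_comp (mdifferentiable_mulgl g h) (mdifferentiable_mulgr g^-1%g (g * h)%g).
by [].
Qed.

(** Linearity comes from differentiability alone: a directional derivative of a
    differentiable map is the value of its (linear) differential. *)
Lemma Ad_linear g : linear (Ad sG g).
Proof. exact: (mdiff_linear (mdifferentiable_conj g 1%g)). Qed.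

Lemma AdM g h v : Ad sG (g * h)%g v = Ad sG g (Ad sG h v).
Proof.
have E : (h * 1 * h^-1 = 1)%g by rewrite mulg1 mulgV.
have conjM : (fun k => g * h * k * (g * h)^-1)%g =
    (fun k => g * k * g^-1)%g \o (fun k => h * k * h^-1)%g.
  by apply/funext => k /=; rewrite invgM !mulgA.
have := mdiff_comp (mdifferentiable_conj h 1%g) (mdifferentiable_conj g _) v.
by rewrite -conjM E /Ad.
Qed.



Lemma Ad1 v : Ad sG 1%g v = v.
Proof.
rewrite /Ad /mdiff.
have -> : (fun h : G => 1 * h * 1^-1)%g = id by apply/funext => h; rewrite invg1 mulg1 mul1g.
set c := chart_at sG 1%g.
rewrite -[RHS](derive_id (c 1%g) v); apply: near_eq_derive.
have oc : open (c @` chart_dom c) by exact: chart_img_open.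
have ci : (c @` chart_dom c) (c 1%g) by exact: chart_at_img.
have : \forall u \near c 1%g, (c @` chart_dom c) u by exact: open_nbhs_nbhs.
by apply: filterS => _ [p pc <-] /=; rewrite chart_funK// mul1g mulgV.
Qed.

End LieGroups.

(** * Differential of a unitary representation *)

Section MatrixDerivatives.
Variables (R : realType) (V : normedModType R) (d : nat).
Implicit Types f : V -> 'M[R[i]]_d.

Definition complex_mx (A B : 'M[R]_d) : 'M[R[i]]_d :=
  \matrix_(i, j) Complex (A i j) (B i j).

Lemma complex_mxD (a : R) (A B A' B' : 'M[R]_d) :
  complex_mx (a *: A + A') (a *: B + B') =
  a%:C%C *: complex_mx A B + complex_mx A' B'.
Proof.
apply/matrixP => i j; rewrite !mxE.
by apply/eqP; rewrite eq_complex /= !mul0r subr0 addr0 !eqxx.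
Qed.

Lemma mx_deriveE f a v :
  mx_derive f a v = complex_mx ('D_v (@re_mx R d \o f) a) ('D_v (@im_mx R d \o f) a).
Proof. by []. Qed.

Lemma derive_linear (W : normedModType R) (g : V -> W) a k u v :
  differentiable g a -> 'D_(k *: u + v) g a = k *: 'D_u g a + 'D_v g a.
Proof. by move=> dg; rewrite !deriveE// linearP. Qed.

Definition mx_derivable f a v :=
  derivable (@re_mx R d \o f) a v /\ derivable (@im_mx R d \o f) a v.

Lemma linear_mx_continuous (W : normedModType R) p q (L : {linear 'M[R]_(p, q) -> W}) :
  continuous L.
Proof.
have -> : L = (fun B : 'M[R]_(p, q) => \sum_i \sum_j B i j *: L (delta_mx i j)) :> (_ -> _).
  apply/funext => B; rewrite {1}(matrix_sum_delta B) linear_sum.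
  apply: eq_bigr => i _; rewrite linear_sum; apply: eq_bigr => j _.
  by rewrite linearZ.
apply: continuous_big => [|i _]; first exact: add_continuous.
apply: continuous_big => [|j _]; first exact: add_continuous.
move=> A; have FA : Filter (nbhs A) by exact: nbhs_filter.
exact: (@cvgZr_tmp R W _ _ FA _ _ _ (@coord_continuous R p q i j A)).
Qed.

Lemma derive_linear_mx (W : normedModType R) p q (L : {linear 'M[R]_(p, q) -> W})
    (g : V -> 'M[R]_(p, q)) a v :
  derivable g a v -> 'D_v (L \o g) a = L ('D_v g a).
Proof.
move=> dg; apply: cvg_lim => //.
have -> : (fun h => h^-1 *: ((L \o g \o shift a) (h *: v) - (L \o g) a)) =
    L \o (fun h => h^-1 *: ((g \o shift a) (h *: v) - g a)).
  by apply/funext => h /=; rewrite [RHS]linearZ [in RHS]linearB.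
by apply: continuous_cvg => //; exact: linear_mx_continuous.
Qed.

Lemma re_mxM (A B : 'M[R[i]]_d) :
  re_mx (A *m B) = re_mx A *m re_mx B - im_mx A *m im_mx B.
Proof.
apply/matrixP => i j; rewrite /re_mx /im_mx !mxE raddf_sum /= -sumrB.
by apply: eq_bigr => k _; rewrite !mxE; case: (A i k) (B k j) => a b [].
Qed.

Lemma im_mxM (A B : 'M[R[i]]_d) :
  im_mx (A *m B) = re_mx A *m im_mx B + im_mx A *m re_mx B.
Proof.
apply/matrixP => i j; rewrite /re_mx /im_mx !mxE raddf_sum /= -big_split.
by apply: eq_bigr => k _; rewrite !mxE; case: (A i k) (B k j) => a b [].
Qed.

Lemma complex_mxK (A : 'M[R[i]]_d) : complex_mx (re_mx A) (im_mx A) = A.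
Proof. by apply/matrixP => i j; rewrite !mxE; case: (A i j). Qed.

Lemma re_complex_mx A B : re_mx (complex_mx A B) = A.
Proof. by apply/matrixP => i j; rewrite !mxE. Qed.

Lemma im_complex_mx A B : im_mx (complex_mx A B) = B.
Proof. by apply/matrixP => i j; rewrite !mxE. Qed.

Lemma derivable_linear_mx (W : normedModType R) p q (L : {linear 'M[R]_(p, q) -> W})
    (g : V -> 'M[R]_(p, q)) a v :
  derivable g a v -> derivable (L \o g) a v.
Proof.
move=> dg; apply/cvg_ex; exists (L ('D_v g a)).
have -> : (fun h => h^-1 *: ((L \o g \o shift a) (h *: v) - (L \o g) a)) =
    L \o (fun h => h^-1 *: ((g \o shift a) (h *: v) - g a)).
  by apply/funext => h /=; rewrite [RHS]linearZ [in RHS]linearB.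
by apply: continuous_cvg => //; exact: linear_mx_continuous.
Qed.

Let re_mull (A : 'M[R[i]]_d) f : @re_mx R d \o (fun x => A *m f x) =
  (mulmx (re_mx A) \o (@re_mx R d \o f)) - (mulmx (im_mx A) \o (@im_mx R d \o f)).
Proof. by apply/funext => x; rewrite /= re_mxM. Qed.

Let im_mull (A : 'M[R[i]]_d) f : @im_mx R d \o (fun x => A *m f x) =
  (mulmx (re_mx A) \o (@im_mx R d \o f)) + (mulmx (im_mx A) \o (@re_mx R d \o f)).
Proof. by apply/funext => x; rewrite /= im_mxM. Qed.

Lemma mx_derivable_mull (A : 'M[R[i]]_d) f a v : mx_derivable f a v ->
  mx_derivable (fun x => A *m f x) a v.
Proof.
move=> [dre dim]; split; rewrite ?re_mull ?im_mull.
  by apply: derivableB; exact: derivable_linear_mx.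
by apply: derivableD; exact: derivable_linear_mx.
Qed.

Lemma mx_deriveMl (A : 'M[R[i]]_d) f a v : mx_derivable f a v ->
  mx_derive (fun x => A *m f x) a v = A *m mx_derive f a v.
Proof.
move=> [dre dim]; rewrite mx_deriveE -[RHS]complex_mxK re_mxM im_mxM.
rewrite !re_complex_mx !im_complex_mx re_mull im_mull.
rewrite deriveB; [|exact: derivable_linear_mx..].
rewrite deriveD; [|exact: derivable_linear_mx..].
by rewrite !derive_linear_mx.
Qed.

Lemma mx_deriveMr (A : 'M[R[i]]_d) f a v : mx_derivable f a v ->
  mx_derive (fun x => f x *m A) a v = mx_derive f a v *m A.
Proof.
move=> [dre dim]; rewrite mx_deriveE -[RHS]complex_mxK re_mxM im_mxM.
rewrite !re_complex_mx !im_complex_mx.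
have reE : re_mx (R:=R) (d:=d) \o (fun x => f x *m A) =
    (mulmxr (re_mx A) \o (re_mx (R:=R) (d:=d) \o f)) -
    (mulmxr (im_mx A) \o (im_mx (R:=R) (d:=d) \o f)).
  by apply/funext => x; rewrite /= re_mxM.
have imE : im_mx (R:=R) (d:=d) \o (fun x => f x *m A) =
    (mulmxr (im_mx A) \o (re_mx (R:=R) (d:=d) \o f)) +
    (mulmxr (re_mx A) \o (im_mx (R:=R) (d:=d) \o f)).
  by apply/funext => x; rewrite /= im_mxM.
rewrite reE imE deriveB; [|exact: derivable_linear_mx..].
rewrite deriveD; [|exact: derivable_linear_mx..].
by rewrite !derive_linear_mx.
Qed.

End MatrixDerivatives.

Section Representation.
Variables (R : realType) (n : nat) (G : ptopGroupType).
Variables (sG : smooth_structure R n G) (hLie : lie_group sG).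
Variables (d : nat) (pi : G -> 'M[R[i]]_d).
Hypothesis hpi : smooth_unitary_representation sG pi.

Lemma rep_differentiable g :
  differentiable (@re_mx R d \o pi \o chart_inv (chart_at sG g)) (chart_at sG g g) /\
  differentiable (@im_mx R d \o pi \o chart_inv (chart_at sG g)) (chart_at sG g g).
Proof.
case: hpi => _ _ _ /(_ (chart_at sG g) (chart_at_atlas _ _)) [/(_ 1%N)[+ _] /(_ 1%N)[+ _]].
by move=> re im; split; [apply: re|apply: im]; exact: chart_at_img.
Qed.

Lemma repV g : invmx (pi g) = pi g^-1%g.
Proof.
case: hpi => pi1 piM _ _.
have gV : pi g *m pi g^-1%g = 1%:M by rewrite -piM mulgV pi1.
have [gu _] := mulmx1_unit gV.
by rewrite -[LHS]mulmx1 -gV mulKmx.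
Qed.

(** The chain rule for [pi \o f] at a point sent to the identity, which is where
    [rep_diff] is computed. *)
Lemma mx_derive_rep (f : G -> G) h v : mdifferentiable sG sG f h ->
  f h = 1%g ->
  mx_derive (pi \o f \o chart_inv (chart_at sG h)) (chart_at sG h h) v =
  rep_diff sG pi (mdiff sG sG f h v).
Proof.
move=> df fh1; have [dre dim] := rep_differentiable (f h).
by rewrite mx_deriveE (derive_mdiff v df dre) (derive_mdiff v df dim) fh1.
Qed.

(** Differentiate [pi (g h g^-1) = pi g *m pi h *m pi g^-1] at [h = 1]. *)
Lemma rep_diff_Ad g Z :
  rep_diff sG pi (Ad sG g Z) = pi g *m rep_diff sG pi Z *m invmx (pi g).
Proof.
have [pi1 piM _ _] := hpi.
have E1 : (g * 1 * g^-1 = 1)%g by rewrite mulg1 mulgV.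
have [dre dim] := rep_differentiable 1%g.
set c := chart_inv (chart_at sG 1%g); set e := chart_at sG 1%g 1%g.
have did : mx_derivable (pi \o c) e Z by split; exact: diff_derivable.
have dc := mdifferentiable_conj hLie g 1%g.
have <- : mx_derive (pi \o (fun h => g * h * g^-1)%g \o c) e Z =
  rep_diff sG pi (Ad sG g Z) by exact: mx_derive_rep.
have -> : pi \o (fun h => g * h * g^-1)%g \o c =
    (fun u => (pi g *m (pi \o c) u) *m pi g^-1%g).
  by apply/funext => u /=; rewrite !piM.
rewrite repV -(mx_deriveMl _ did); apply: mx_deriveMr.
exact: mx_derivable_mull.
Qed.


Lemma rep_diff_linear (a : R) u v :
  rep_diff sG pi (a *: u + v) = a%:C%C *: rep_diff sG pi u + rep_diff sG pi v.
Proof.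
have [dre dim] := rep_differentiable 1%g.
rewrite /rep_diff !mx_deriveE -complex_mxD.
congr complex_mx; exact: derive_linear.
Qed.

(** The curve [t |-> pi (gam t) *m pi (gam 0)^-1] is the image under [pi] of
    [t |-> gam t * (gam 0)^-1], which passes through the identity with velocity
    the right translate of the velocity of [gam]. *)
Lemma mx_derive_right_translate (gam : R -> G) :
  has_velocity sG gam 0 ->
  mx_derive (pi \o gam) 0 1 *m invmx (pi (gam 0)) =
  rep_diff sG pi (right_translate sG (gam 0) (velocity sG gam 0)).
Proof.
move=> vgam; have [pi1 piM _ _] := hpi.
set f := fun h => (h * (gam 0)^-1)%g.
have df : mdifferentiable sG sG f (gam 0) by exact: mdifferentiable_mulgr.
have fg1 : f (gam 0) = 1%g by rewrite /f mulgV.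
have [dre dim] := rep_differentiable (gam 0).
have mxd : mx_derivable (pi \o gam) 0 1.
  by split; [exact: (derivable_velocity vgam dre)|exact: (derivable_velocity vgam dim)].
rewrite repV; have <- := mx_deriveMr (pi (gam 0)^-1%g) mxd.
have -> : (fun x => (pi \o gam) x *m pi (gam 0)^-1%g) = pi \o (f \o gam).
  by apply/funext => x /=; rewrite piM.
have vfgam := has_velocity_comp vgam df.
have [] := rep_differentiable ((f \o gam) 0).
move=> /(derive_velocity vfgam) dre' /(derive_velocity vfgam) dim'.
rewrite /right_translate -/f -(velocity_comp vgam df).
by rewrite mx_deriveE dre' dim' /= fg1.
Qed.

End Representation.

(** * Continuity of the differential for the operator norm *)

Section OperatorNormBound.
Variables (R : realType) (d : nat).
Implicit Types (A B : 'M[R[i]]_d) (v : 'cV[R[i]]_d).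

(** A norm on matrices, equivalent to the operator norm, for which the
    dependence on the entries is explicit. *)
Definition entry_norm (A : 'M[R[i]]_d) : R :=
  \sum_i \sum_j (`|complex.Re (A i j)| + `|complex.Im (A i j)|).

Lemma entry_norm_scaleD (a : R) A B :
  entry_norm (a%:C%C *: A + B) <= `|a| * entry_norm A + entry_norm B.
Proof.
rewrite /entry_norm mulr_sumr -big_split; apply: ler_sum => i _ /=.
rewrite mulr_sumr -big_split; apply: ler_sum => j _ /=.
rewrite !mxE; case: (A i j) (B i j) => x y [z w] /=.
rewrite !mul0r subr0 addr0 mulrDr -!normrM addrACA lerD//; exact: ler_normD.
Qed.

Lemma l2norm_ge_entry v i :
  `|complex.Re (v i 0)| <= l2norm v /\ `|complex.Im (v i 0)| <= l2norm v.
Proof.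
have vi : complex.Re (v i 0) ^+ 2 + complex.Im (v i 0) ^+ 2 <=
    \sum_(i < d) (complex.Re (v i 0) ^+ 2 + complex.Im (v i 0) ^+ 2).
  rewrite [leRHS](bigD1 i)//= lerDl; apply: sumr_ge0 => j _.
  by rewrite addr_ge0// sqr_ge0.
by rewrite /l2norm -!sqrtr_sqr; split; apply: ler_wsqrtr; apply: le_trans vi;
  rewrite ?lerDl ?lerDr sqr_ge0.
Qed.

Lemma l2norm_le_entries v :
  l2norm v <= \sum_i (`|complex.Re (v i 0)| + `|complex.Im (v i 0)|).
Proof.
set s := \sum_i _; have s0 : 0 <= s by apply: sumr_ge0 => i _; rewrite addr_ge0.
rewrite -(ger0_norm s0) -sqrtr_sqr; apply: ler_wsqrtr.
rewrite {1}/s expr2 mulr_suml; apply: ler_sum => i _.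
have si : `|complex.Re (v i 0)| + `|complex.Im (v i 0)| <= s.
  by rewrite /s [leRHS](bigD1 i)//= lerDl; apply: sumr_ge0 => j _; rewrite addr_ge0.
rewrite -[X in X + _]real_normK ?num_real// -[X in _ + X]real_normK ?num_real//.
set x := `|_| in si *; set y := `|_| in si *.
have [x0 y0] : 0 <= x /\ 0 <= y by split; exact: normr_ge0.
apply: (@le_trans _ _ ((x + y) * (x + y))).
  by rewrite -expr2 sqrrD -addrA lerD2l lerDr mulrn_wge0// mulr_ge0.
by rewrite ler_wpM2l// addr_ge0.
Qed.

Lemma opnorm_bounds A : 0 <= opnorm A <= 2 * entry_norm A.
Proof.
set S := [set l2norm (A *m v) | v in [set v : 'cV[R[i]]_d | l2norm v <= 1]].
have S0 : S 0.
  exists 0.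
    by rewrite /= /l2norm big1 ?sqrtr0// => i _; rewrite mxE /= expr0n addr0.
  by rewrite mulmx0 /l2norm big1 ?sqrtr0// => i _; rewrite mxE /= expr0n addr0.
have ubS : ubound S (2 * entry_norm A).
  move=> _ [v /= v1 <-]; apply: (le_trans (l2norm_le_entries _)).
  rewrite mulr_sumr; apply: ler_sum => i _; rewrite !mxE !raddf_sum /=.
  apply: (le_trans (lerD (ler_norm_sum _ _ _) (ler_norm_sum _ _ _))).
  rewrite -big_split mulr_sumr; apply: ler_sum => j _ /=.
  have [] := l2norm_ge_entry v j => /le_trans/(_ v1) re /le_trans/(_ v1) im.
  case: (A i j) (v j 0) re im => x y [z w] /= z1 w1.
  have le1 (a b : R) : `|b| <= 1 -> `|a * b| <= `|a|.
    by move=> b1; rewrite normrM ler_piMr.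
  rewrite mulr2n mulrDl mul1r lerD//.
    apply: (le_trans (ler_normB _ _)); rewrite lerD//; exact: le1.
  apply: (le_trans (ler_normD _ _)); rewrite lerD//; exact: le1.
apply/andP; split.
  by apply: (@ub_le_sup _ S) => //; exists (2 * entry_norm A).
by apply: ge_sup => //; exists 0.
Qed.

End OperatorNormBound.

Section RepDiffBound.
Variables (R : realType) (n : nat) (G : ptopGroupType).
Variables (sG : smooth_structure R n G).
Variables (d : nat) (pi : G -> 'M[R[i]]_d).
Hypothesis hpi : smooth_unitary_representation sG pi.

Lemma rep_diff0 : rep_diff sG pi 0 = 0.
Proof.
have := rep_diff_linear hpi 1 0 0.
rewrite scaler0 add0r scale1r => E; apply: (addrI (rep_diff sG pi 0)).
by rewrite addr0 -E.
Qed.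

Lemma rep_diffD u v : rep_diff sG pi (u + v) = rep_diff sG pi u + rep_diff sG pi v.
Proof. by rewrite -{1}[u]scale1r rep_diff_linear// scale1r. Qed.

Lemma rep_diffZ (a : R) u : rep_diff sG pi (a *: u) = a%:C%C *: rep_diff sG pi u.
Proof. by rewrite -[a *: u]addr0 rep_diff_linear// rep_diff0 addr0. Qed.

Lemma opnorm_rep_diff_le Z : opnorm (rep_diff sG pi Z) <=
  2 * \sum_k `|Z 0 k| * entry_norm (rep_diff sG pi (delta_mx 0 k)).
Proof.
apply: le_trans (proj2 (andP (opnorm_bounds _))) _; rewrite ler_pM2l//.
rewrite {1}(row_sum_delta Z).
elim/big_rec2: _ => [|k x A _ xA].
  rewrite rep_diff0 /entry_norm big1// => i _; rewrite big1// => j _.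
  by rewrite mxE normr0 addr0.
rewrite rep_diff_linear//; apply: le_trans (entry_norm_scaleD _ _ _) _.
by rewrite lerD2l.
Qed.

Lemma opnorm_rep_diff_cvg0 (Z : nat -> 'rV[R]_n) :
  (forall k, (fun N => Z N 0 k) @ \oo --> (0 : R)) ->
  (fun N => opnorm (rep_diff sG pi (Z N))) @ \oo --> (0 : R).
Proof.
move=> Z0; pose C k := entry_norm (rep_diff sG pi (delta_mx 0 k)).
have ub : (fun N => 2 * \sum_k `|Z N 0 k| * C k) @ \oo --> (0 : R).
  have E : 2 * \sum_(k < n) `|0 : R| * C k = 0.
    by rewrite big1 ?mulr0// => k _; rewrite normr0 mul0r.
  rewrite -[X in _ --> X]E; apply: cvgM; first exact: cvg_cst.
  apply: cvg_big => [|k _]; first exact: add_continuous.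
  by apply: cvgM; [apply: cvg_norm; exact: Z0 | exact: cvg_cst].
apply: (squeeze_cvgr _ (cvg_cst 0) ub); apply: nearW => N.
by rewrite opnorm_rep_diff_le andbT; case/andP: (opnorm_bounds (rep_diff sG pi (Z N))).
Qed.

End RepDiffBound.

(** * Borel measurability of the adjoint action *)

Section BorelMeasurability.
Variable R : realType.

Lemma continuous_borel_measurable (S T : ptopologicalType) (f : S -> T) :
  continuous f -> measurable_fun [set: borel S] (f : borel S -> borel T).
Proof.
move=> /continuousP cf; apply: (@measurability _ _ (borel S) (borel T) _ f (@open T)) => //.
by move=> _ [U oU <-]; rewrite setTI; apply: sub_sigma_algebra; exact: cf.
Qed.

Lemma continuous_borel_measurable_real (T : ptopologicalType) (f : T -> R) :
  continuous f -> measurable_fun [set: borel T] (f : borel T -> R).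
Proof.
move=> /continuousP cf; apply: (measurability _ (RGenOpens.measurableE R)).
move=> _ [_ [a [b ->]] <-]; rewrite setTI; apply: sub_sigma_algebra.
exact/cf/interval_open.
Qed.

(** Charts carry no information outside their domain, so they only become Borel
    functions once cut off there. *)
Lemma restrict_borel_measurable (T : ptopologicalType) (U : set T) (f : T -> R) :
  open U -> (forall x, U x -> {for x, continuous f}) ->
  measurable_fun [set: borel T] ((f \_ U) : borel T -> R).
Proof.
move=> oU cf.
have mU : @measurable _ (borel T) U by exact: sub_sigma_algebra.
apply/(measurable_restrictT _ mU).
apply: (measurability _ (RGenOpens.measurableE R)).
move=> _ [_ [a [b ->]] <-]; apply: sub_sigma_algebra.
rewrite openE => x [Ux fx]; apply: filterI; first exact: open_nbhs_nbhs.
by apply: (cf x Ux); apply: open_nbhs_nbhs; split; [exact: interval_open|exact: fx].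
Qed.

(** An open set of row vectors is a countable union of boxes with rational
    centre and radius [1 / (k + 1)], and the preimage of a box is a finite
    intersection of preimages of intervals. *)
Lemma measurable_rV d (T : measurableType d) n (f : T -> 'rV[R]_n) :
  (forall i, measurable_fun [set: T] (fun x => f x 0 i)) ->
  measurable_fun [set: T] (f : T -> borel 'rV[R]_n).
Proof.
move=> mf; apply: (@measurability _ _ T (borel 'rV[R]_n) _ f (@open 'rV[R]_n)) => //.
move=> _ [U oU <-]; rewrite setTI.
pose B (q : 'rV[rat]_n * nat) : set 'rV[R]_n :=
  [set u | forall j, `|ratr (q.1 0 j) - u 0 j| < q.2.+1%:R^-1].
have -> : f @^-1` U = \bigcup_(q in [set q | B q `<=` U]) (f @^-1` B q).
  apply/seteqP; split=> [x Ux|x [q qU /qU]//].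
  have /nbhs_ballP [e e0 eU] : nbhs (f x) U by exact: open_nbhs_nbhs.
  have [k ke] : exists k : nat, k.+1%:R^-1 < e / 2.
    have e20 : 0 < e / 2 by rewrite divr_gt0.
    have [k _ kP] := near_infty_natSinv_lt (PosNum e20).
    by exists k; apply: kP => /=.
  have qx j : {q : rat | `|ratr q - f x 0 j| < k.+1%:R^-1}.
    apply: cid; have [q] : exists q : rat,
        ratr q \in `]f x 0 j - k.+1%:R^-1, f x 0 j + k.+1%:R^-1[.
      apply: rat_in_itvoo; rewrite ltrBlDr -addrA ltrDl addr_gt0 ?invr_gt0 ?ltr0n//.
    by rewrite in_itv /= => qP; exists q; rewrite ltr_distl.
  (* the box of half the radius around a nearby rational centre contains f x *)
  exists (\row_j sval (qx j), k) => /=; last first.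
    by move=> j /=; rewrite mxE; case: (qx j).
  move=> u /= Bu; apply: eU; split=> // i j; rewrite !ord1.
  rewrite /ball/=; move: (Bu j); rewrite mxE /=; case: (qx j) => q /= qx' qu.
  rewrite (splitr e) -(subrKA (ratr q)) (le_lt_trans (ler_normD _ _))// ltrD//.
    by rewrite distrC; exact: lt_trans ke.
  exact: lt_trans ke.
rewrite bigcup_mkcond; apply: countable_bigcupT_measurable.
  exact: countableP.
move=> q; case: ifPn => // _.
have -> : f @^-1` B q = \bigcap_(j in [set: 'I_n])
    (fun x => f x 0 j) @^-1` ball (ratr (q.1 0 j) : R) q.2.+1%:R^-1.
  by apply/seteqP; split=> [x Bx j _|x Bx j]; [exact: Bx|exact: (Bx j Logic.I)].
apply: fin_bigcap_measurable; first exact: finite_finset.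
move=> j _; rewrite -[X in measurable X]setTI; apply: mf => //.
by apply: open_measurable; exact: ball_open.
Qed.

Lemma measurable_fun_cvg_real d (T : measurableType d) (f_ : nat -> T -> R) (f : T -> R) :
  (forall N, measurable_fun [set: T] (f_ N)) ->
  (forall x, f_ ^~ x @ \oo --> f x) -> measurable_fun [set: T] f.
Proof.
move=> mf cf; apply/measurable_EFinP.
apply: (emeasurable_fun_cvg (fun N x => (f_ N x)%:E)) => [N|x _].
  exact/measurable_EFinP.
by apply/cvg_EFin; [exact: nearW|exact: cf].
Qed.

End BorelMeasurability.

Section AdMeasurable.
Variables (R : realType) (n : nat) (G : ptopGroupType).
Variables (sG : smooth_structure R n G) (hLie : lie_group sG).

(** [Ad g Z] is the limit of the difference quotients of [c (g * h * g^-1)]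
    along the points [h = k N], which do not depend on [g]; at each fixed [N] the
    quotient is a cut-off chart composed with a continuous function of [g]. *)
Lemma Ad_measurable (Z : 'rV[R]_n) i :
  measurable_fun [set: borel G] ((fun g => Ad sG g Z 0 i) : borel G -> R).
Proof.
pose c := chart_at sG (1%g : G); pose e := c 1%g.
pose k (N : nat) : G := chart_inv c (N.+1%:R^-1 *: Z + e).
pose cp : G -> R := (fun g => c g 0 i) \_ (chart_dom c).
pose q (N : nat) (g : G) : R := N.+1%:R * (cp (g * k N * g^-1)%g - e 0 i).
apply: (@measurable_fun_cvg_real R _ (borel G) q) => [N|g].
  apply: measurable_funM => //; apply: measurable_funB => //.
  apply: (measurableT_comp (f := cp : borel G -> R)).
    apply: restrict_borel_measurable; first exact: chart_dom_open.
    move=> x cx; apply: (@continuous_comp _ _ _ c (fun u : 'rV[R]_n => u 0 i)).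
      exact: chart_continuous.
    exact: coord_continuous.
  apply: continuous_borel_measurable => g.
  apply: (@continuous_comp _ _ _ (fun g => (g * k N, g^-1)%g) (fun p : G * G => p.1 * p.2)%g).
    have cr : {for g, continuous (fun h => h * k N)%g} by exact: (mulgr_continuous hLie).
    have ci : {for g, continuous (fun h => h^-1)%g} by exact: (invg_continuous hLie).
    by apply: cvg_pair => /=; [exact: cr|exact: ci].
  exact: (mulg_continuous hLie).
have [cconj dconj] := mdifferentiable_conj hLie g 1%g.
have E1 : (g * 1 * g^-1 = 1)%g by rewrite mulg1 mulgV.
pose f := c \o (fun h => g * h * g^-1)%g \o chart_inv c.
have df : derivable f e Z.
  by apply: diff_derivable; move: dconj; rewrite E1.
have fe : f e = e by rewrite /f /= /e chart_atK E1.
have -> : Ad sG g Z 0 i = 'D_Z f e 0 i.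
  by rewrite /Ad /mdiff E1.
have cvf := derive_cvg_harmonic df.
have {}cvf := cvg_comp _ _ cvf (@coord_continuous R 1 n 0 i _).
apply: cvg_trans cvf; apply: near_eq_cvg.
have kd : \forall N \near \oo, chart_dom c (g * k N * g^-1)%g.
  have -> : k = chart_inv c \o (fun N => N.+1%:R^-1 *: Z + e) by [].
  have ce : (fun N => N.+1%:R^-1 *: Z + e) @ \oo --> e.
    have E : 0 *: Z + e = e by rewrite scale0r add0r.
    rewrite -[X in _ --> X]E.
    apply: cvgD; last exact: cvg_cst.
    by apply: cvgZr_tmp; exact: cvg_harmonic.
  have := cvg_comp _ _ ce (continuous_chart_inv cconj).
  rewrite /= chart_atK E1; apply.
  apply: open_nbhs_nbhs; split; first exact: chart_dom_open.
  exact: chart_at_dom.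
apply: filterS kd => N kN.
by rewrite /= /q /cp patchE mem_set// !mxE fe /f /k.
Qed.

End AdMeasurable.

(** * Scalar products on row vectors *)

Section ScalarProduct.
Variables (R : realType) (n : nat) (ip : 'rV[R]_n -> 'rV[R]_n -> R).
Hypotheses (ip_lin : forall v, scalar (ip^~ v)) (ip_sym : forall u v, ip u v = ip v u).
Hypothesis ip_pos : forall u, u != 0 -> 0 < ip u u.
Implicit Types u v w : 'rV[R]_n.

Lemma ip0l v : ip 0 v = 0.
Proof.
by have := ip_lin v 1 0 0; rewrite scaler0 addr0 => ?; lra.
Qed.

Lemma ipDl u v w : ip (u + v) w = ip u w + ip v w.
Proof. by have := ip_lin w 1 u v; rewrite scale1r mul1r. Qed.

Lemma ipZl a u w : ip (a *: u) w = a * ip u w.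
Proof. by have := ip_lin w a u 0; rewrite !addr0 ip0l addr0. Qed.

Lemma ipDr u v w : ip u (v + w) = ip u v + ip u w.
Proof. by rewrite ip_sym ipDl !(ip_sym u). Qed.

Lemma ipZr a u w : ip u (a *: w) = a * ip u w.
Proof. by rewrite ip_sym ipZl ip_sym. Qed.

Lemma ipNl u w : ip (- u) w = - ip u w.
Proof. by rewrite -scaleN1r ipZl mulN1r. Qed.

Lemma ipNr u w : ip u (- w) = - ip u w.
Proof. by rewrite ip_sym ipNl ip_sym. Qed.

Lemma ip_ge0 u : 0 <= ip u u.
Proof. by have [->|/ip_pos/ltW//] := eqVneq u 0; rewrite ip0l. Qed.

Lemma ip_eq0 u : ip u u = 0 -> u = 0.
Proof. by move=> u0; apply: contra_eq u0 => /ip_pos; rewrite lt0r => /andP[]. Qed.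

Lemma ip_parallelogram u v :
  ip (u + v) (u + v) + ip (u - v) (u - v) = 2 * ip u u + 2 * ip v v.
Proof. by rewrite !(ipDl, ipDr, ipNl, ipNr) (ip_sym v u); lra. Qed.

Lemma ip_normD u v : ip (u + v) (u + v) <= 2 * ip u u + 2 * ip v v.
Proof. by rewrite -ip_parallelogram lerDl ip_ge0. Qed.

Lemma ip_normN u : ip (- u) (- u) = ip u u.
Proof. by rewrite ipNl ipNr opprK. Qed.

Lemma ip_normB u v : ip (u - v) (u - v) <= 2 * ip u u + 2 * ip v v.
Proof. by rewrite -(ip_normN v) ip_normD. Qed.

Lemma ip_le_normsq u v : `|ip u v| <= ip u u + ip v v.
Proof.
have := ip_ge0 (u + v); have := ip_ge0 (u - v).
have := ip_ge0 u; have := ip_ge0 v.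
by rewrite !(ipDl, ipDr, ipNl, ipNr) (ip_sym v u) ler_norml => *; lra.
Qed.

Lemma ip_CauchySchwarz u w : ip u w ^+ 2 <= ip u u * ip w w.
Proof.
have [->|w0] := eqVneq w 0; first by rewrite ip_sym !ip0l expr0n mulr0.
have q0 := ip_pos w0.
have := ip_ge0 (ip w w *: u - ip u w *: w).
rewrite !(ipDl, ipDr, ipNl, ipNr, ipZl, ipZr) (ip_sym w u) => h.
rewrite -subr_ge0 -(pmulr_rge0 _ q0); apply: le_trans h _.
by rewrite le_eqVlt; apply/orP; left; apply/eqP; ring.
Qed.

(** Jensen's inequality for the convex function [u |-> ip u u]. It lets the
    averages of vectors be controlled by averages of squared norms. *)
Lemma ip_sum_le (h : nat -> 'rV[R]_n) N :
  ip (\sum_(0 <= k < N) h k) (\sum_(0 <= k < N) h k) <=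
  N%:R * \sum_(0 <= k < N) ip (h k) (h k).
Proof.
have sumr u M : ip u (\sum_(0 <= k < M) h k) = \sum_(0 <= k < M) ip u (h k).
  elim: M => [|M IH]; first by rewrite !big_geq// ip_sym ip0l.
  by rewrite !big_nat_recr//= ipDr IH.
elim: N => [|N IH]; first by rewrite !big_geq// ip0l mul0r.
rewrite !big_nat_recr//= ipDl !ipDr (ip_sym (h N)).
set s := \sum_(0 <= k < N) h k in IH *; set t := \sum_(0 <= k < N) _ in IH *.
have st : 2 * ip s (h N) <= t + N%:R * ip (h N) (h N).
  rewrite ip_sym sumr mulr_sumr /t.
  have -> : N%:R * ip (h N) (h N) = \sum_(0 <= k < N) ip (h N) (h N).
    by rewrite sumr_const_nat subn0 mulr_natl.
  rewrite -big_split; apply: ler_sum => k _ /=.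
  have := ip_ge0 (h k - h N).
  by rewrite !(ipDl, ipDr, ipNl, ipNr) (ip_sym (h k)) => *; lra.
rewrite -natr1; lra.
Qed.

Lemma ip_coords u v :
  ip u v = \sum_i \sum_j u 0 i * v 0 j * ip (delta_mx 0 i) (delta_mx 0 j).
Proof.
have suml w (I : finType) (F : I -> 'rV[R]_n) : ip (\sum_i F i) w = \sum_i ip (F i) w.
  by elim/big_rec2: _ => [|i a b _ <-]; rewrite ?ip0l ?ipDl.
rewrite {1}(row_sum_delta u) suml; apply: eq_bigr => i _.
rewrite ipZl ip_sym {1}(row_sum_delta v) suml mulr_sumr; apply: eq_bigr => j _.
by rewrite ipZl mulrA (ip_sym (delta_mx 0 j)).
Qed.

(** The Gram matrix is invertible, so each coordinate is the scalar product with
    a fixed vector [w i] and Cauchy-Schwarz applies. *)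
Lemma coord_le_ip : exists2 C : R, 0 <= C & forall u i, u 0 i ^+ 2 <= C * ip u u.
Proof.
pose A : 'M[R]_n := \matrix_(i, j) ip (delta_mx 0 i) (delta_mx 0 j).
have ipE u v : ip u v = (u *m A *m v^T) 0 0.
  rewrite ip_coords mxE exchange_big; apply: eq_bigr => j _ /=.
  rewrite !mxE mulr_suml; apply: eq_bigr => i _; rewrite !mxE.
  by rewrite mulrAC.
have Au : A \in unitmx.
  rewrite -row_free_unit; apply: inj_row_free => v vA.
  by apply: ip_eq0; rewrite ipE vA mul0mx mxE.
pose w i : 'rV[R]_n := (invmx A *m (delta_mx 0 i)^T)^T.
have wE u i : ip u (w i) = u 0 i.
  rewrite ipE /w trmxK -mulmxA mulKVmx// trmx_delta mxE.
  rewrite (bigD1 i)//= !mxE !eqxx mulr1 big1 ?addr0// => j ji.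
  by rewrite !mxE (negbTE ji) mulr0.
exists (\sum_i ip (w i) (w i)) => [|u i]; first by apply: sumr_ge0 => i _; exact: ip_ge0.
rewrite -wE; apply: le_trans (ip_CauchySchwarz _ _) _.
rewrite mulrC ler_wpM2r ?ip_ge0// (bigD1 i)//= lerDl.
by apply: sumr_ge0 => j _; exact: ip_ge0.
Qed.

Lemma measurable_ip d (T : measurableType d) (f g : T -> 'rV[R]_n) :
  (forall i, measurable_fun [set: T] (fun x => f x 0 i)) ->
  (forall i, measurable_fun [set: T] (fun x => g x 0 i)) ->
  measurable_fun [set: T] (fun x => ip (f x) (g x)).
Proof.
move=> mf mg; under eq_fun do rewrite ip_coords.
apply: measurable_sum => i; apply: measurable_sum => j.
by apply: measurable_funM => //; exact: measurable_funM.
Qed.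

End ScalarProduct.

(** * The maximal ergodic inequality *)

Section MaximalErgodic.
Context d (T : measurableType d) (R : realType) (mu : probability T R) (tau : T -> T).
Hypothesis mtau : measurable_fun [set: T] tau.
Hypothesis inv : forall A, measurable A -> mu (tau @^-1` A) = mu A.

Let ge0_integral_invariant_ereal (u : T -> \bar R) : measurable_fun [set: T] u ->
  (forall x, 0 <= u x)%E -> (\int[mu]_x u (tau x) = \int[mu]_x u x)%E.
Proof.
move=> meas_u u0.
have := @ge0_integral_pushforward _ _ T T R tau mtau mu setT u measurableT meas_u.
move=> /(_ (fun x _ => u0 x))/esym; rewrite preimage_setT => ->.
by apply: eq_measure_integral => A mA _; exact: inv.
Qed.

Lemma ge0_integral_invariant (u : T -> R) : measurable_fun [set: T] u ->
  (forall x, 0 <= u x) -> (\int[mu]_x (u (tau x))%:E = \int[mu]_x (u x)%:E)%E.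
Proof.
move=> meas_u u0; apply: (ge0_integral_invariant_ereal (u := EFin \o u)).
  exact/measurable_EFinP.
by move=> x; rewrite lee_fin.
Qed.

Lemma Rintegral_invariant (u : T -> R) : measurable_fun [set: T] u ->
  \int[mu]_x u (tau x) = \int[mu]_x u x.
Proof.
move=> meas_u; have mEu : measurable_fun setT (EFin \o u) by exact/measurable_EFinP.
congr fine; rewrite integralE [RHS]integralE.
have := ge0_integral_invariant_ereal (measurable_funepos mEu) (funepos_ge0 _).
have := ge0_integral_invariant_ereal (measurable_funeneg mEu) (funeneg_ge0 _).
move=> hn hp; rewrite -hp -hn.
by congr (_ - _)%E; apply: eq_integral => x _; rewrite ?funeposE ?funenegE.
Qed.

Lemma ae_invariant (P : T -> Prop) :
  {ae mu, forall x, P x} -> {ae mu, forall x, P (tau x)}.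
Proof.
move=> [A [mA A0 PA]]; exists (tau @^-1` A); split.
- by rewrite -[X in measurable X]setTI; exact: mtau.
- by rewrite inv.
- by move=> x nPx; exact: PA.
Qed.

Lemma ae_invariant_iter (P : T -> Prop) k :
  {ae mu, forall x, P x} -> {ae mu, forall x, P (iter k tau x)}.
Proof.
elim: k => // k IH /IH /ae_invariant.
by apply: filterS => x; rewrite iterSr.
Qed.

Section Maximal.
Variables (u : T -> R) (l : R).
Hypotheses (meas_u : measurable_fun [set: T] u) (u0 : forall x, 0 <= u x) (l0 : 0 <= l).
Hypothesis int_u : (\int[mu]_x (u x)%:E < +oo)%E.

(** The largest of the sums of [u - l] over the first [j] points of the orbit of
    [x], for [0 <= j <= k]. The recursion is the form in which Garsia's argument
    uses it. *)
Fixpoint maximal_sum (k : nat) (x : T) : R :=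
  if k is k'.+1 then Num.max 0 (u x - l + maximal_sum k' (tau x)) else 0.

Let M := maximal_sum.

Let M_ge0 k x : 0 <= M k x.
Proof. by case: k => //= k; rewrite le_max lexx. Qed.

Let mM k : measurable_fun [set: T] (M k).
Proof.
elim: k => [|k IH] /=; first exact: measurable_cst.
apply: measurable_maxr; first exact: measurable_cst.
apply: measurable_funD; first exact: measurable_funB.
exact: (measurableT_comp IH mtau).
Qed.

Let M_nd k x : M k x <= M k.+1 x.
Proof.
elim: k x => [|k IH] x; first exact: M_ge0.
by rewrite /M /= ge_max !le_max lexx /= lerD2l IH orbT.
Qed.

Let M_sum k x : \sum_(0 <= j < k) (u (iter j tau x) - l) <= M k x.
Proof.
elim: k x => [|k IH] x; first by rewrite big_geq.
rewrite big_nat_recl//= le_max; apply/orP; right; rewrite lerD2l.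
apply: le_trans (IH (tau x)); apply: ler_sum => j _; by rewrite -iterSr.
Qed.

Let M_le k x : M k.+1 x <= u x + M k (tau x).
Proof.
by rewrite /M /= ge_max addr_ge0 ?M_ge0//= lerD2r gerBl.
Qed.

Let intM k : (\int[mu]_x (M k x)%:E < +oo)%E.
Proof.
elim: k => [|k IH]; first by rewrite integral0_eq.
apply: (@le_lt_trans _ _ (\int[mu]_x ((u x)%:E + (M k (tau x))%:E))%E).
  apply: ge0_le_integral => //.
  - by move=> x _; rewrite lee_fin M_ge0.
  - exact/measurable_EFinP.
  - apply: emeasurable_funD; apply/measurable_EFinP => //.
    exact: (measurableT_comp (mM k) mtau).
  - by move=> x _; rewrite -EFinD lee_fin M_le.
rewrite ge0_integralD//.
- by rewrite ge0_integral_invariant//; exact: lte_add_pinfty.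
- by move=> x _; rewrite lee_fin.
- exact/measurable_EFinP.
- by move=> x _; rewrite lee_fin M_ge0.
- apply/measurable_EFinP; exact: (measurableT_comp (mM k) mtau).
Qed.

Let E k := [set x | 0 < M k x].

Let mE k : measurable (E k).
Proof.
rewrite -[E k]setTI; have -> : E k = M k @^-1` `]0, +oo[.
  by apply/seteqP; split=> x /=; rewrite in_itv /= andbT.
exact: mM.
Qed.

(* Where the maximum is positive, it is attained with at least one term, namely
   u x - l, followed by a sum over the orbit of tau x. *)
Let hopf k x : l * \1_(E k.+1) x + M k.+1 x <= u x + M k (tau x).
Proof.
rewrite indicE; case: (boolP (x \in E k.+1)) => [|_]; last by rewrite mulr0 add0r M_le.
rewrite inE /E /M /= lt_max ltxx /= => pos.
rewrite /M /= (max_r (ltW pos)) mulr1; lra.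
Qed.

Let muE k : (l%:E * mu (E k.+1) <= \int[mu]_x (u x)%:E)%E.
Proof.
have Mt : measurable_fun [set: T] (fun x => M k (tau x)) by exact: (measurableT_comp (mM k) mtau).
have mi : measurable_fun [set: T] (fun x => l * \1_(E k.+1) x).
  apply: measurable_funM; first exact: measurable_cst.
  exact: measurable_indic.
have : (\int[mu]_x ((l * \1_(E k.+1) x)%:E + (M k.+1 x)%:E) <=
    \int[mu]_x ((u x)%:E + (M k (tau x))%:E))%E.
  apply: ge0_le_integral => //.
  - by move=> x _; rewrite -EFinD lee_fin addr_ge0 ?M_ge0// mulr_ge0.
  - by apply: emeasurable_funD; exact/measurable_EFinP.
  - by apply: emeasurable_funD; exact/measurable_EFinP.
  - by move=> x _; rewrite -!EFinD lee_fin hopf.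
rewrite !ge0_integralD//; first last.
- exact/measurable_EFinP.
- by move=> x _; rewrite lee_fin M_ge0.
- exact/measurable_EFinP.
- by move=> x _; rewrite lee_fin mulr_ge0.
- exact/measurable_EFinP.
- by move=> x _; rewrite lee_fin M_ge0.
- exact/measurable_EFinP.
- by move=> x _; rewrite lee_fin u0.
rewrite (ge0_integral_invariant (mM k) (M_ge0 k)).
have -> : (\int[mu]_x (l * \1_(E k.+1) x)%:E = l%:E * mu (E k.+1))%E.
  under eq_integral do rewrite EFinM.
  rewrite ge0_integralZl_EFin//; last by apply/measurable_EFinP; exact: measurable_indic.
  by rewrite integral_indic// setIT.
move=> /le_trans h; rewrite -(@leeD2rE _ (\int[mu]_x (M k.+1 x)%:E)); last first.
  by rewrite ge0_fin_numE ?intM// integral_ge0// => x _; rewrite lee_fin M_ge0.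
apply: h; apply: leeD => //; apply: ge0_le_integral => //.
- by move=> x _; rewrite lee_fin M_ge0.
- exact/measurable_EFinP.
- exact/measurable_EFinP.
- by move=> x _; rewrite lee_fin M_nd.
Qed.

(** Integrate [hopf]: by invariance the integrals of [M k.+1] and of
    [M k \o tau <= M k.+1 \o tau] cancel, being finite, and what remains bounds
    the measure of the set where some average exceeds [l]. *)
Lemma maximal_ergodic_inequality : exists A : set T,
  [/\ measurable A, (l%:E * mu A <= \int[mu]_x (u x)%:E)%E &
   forall x, ~ A x -> forall k, \sum_(0 <= j < k) u (iter j tau x) <= k%:R * l].
Proof.
have mA : measurable (\bigcup_k E k) by exact: bigcupT_measurable.
exists (\bigcup_k E k); split => //.
  have ndE : nondecreasing_seq E.
    apply/nondecreasing_seqP => k; apply/subsetPset => x /=.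
    by move=> /lt_le_trans; apply; exact: M_nd.
  have cv : (fun k => l%:E * mu (E k))%E @ \oo --> (l%:E * mu (\bigcup_k E k))%E.
    by apply: cvgeZl => //; exact: nondecreasing_cvg_mu.
  apply: (cvge_le _ cv); near=> k.
  by near: k; exists 1%N => // -[//|k] _; exact: muE.
move=> x Ax k; have Mkx : M k x <= 0.
  by rewrite leNgt; apply/negP => pos; apply: Ax; exists k.
have := le_trans (M_sum k x) Mkx.
by rewrite sumrB subr_le0 sumr_const_nat subn0 mulr_natl.
Unshelve. all: by end_near. Qed.

End Maximal.

Lemma measure_eq0_le_inv (A : set T) (c : R) : measurable A ->
  (forall k : nat, (k%:R%:E * mu A <= c%:E)%E) -> mu A = 0%E.
Proof.
move=> mA cA; have Afin : mu A \is a fin_num by exact: fin_num_measure.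
rewrite -(fineK Afin); congr EFin; apply/eqP; rewrite eq_le fine_ge0// andbT leNgt.
apply/negP => A0; pose a := fine (mu A).
have := cA (Num.truncn (c / a)).+1; rewrite -(fineK Afin) -EFinM lee_fin leNgt.
by rewrite -ltr_pdivrMr// truncnS_gt.
Qed.

(** The set where the averages exceed every integer [k] is contained in the
    exceptional set of the maximal inequality for each [l = k], whose measure is
    at most [(\int u) / k]. *)
Lemma ae_bounded_averages (u : T -> R) : measurable_fun [set: T] u ->
  (forall x, 0 <= u x) -> (\int[mu]_x (u x)%:E < +oo)%E ->
  {ae mu, forall x, exists C : R, forall k, \sum_(0 <= j < k) u (iter j tau x) <= k%:R * C}.
Proof.
move=> meas_u u0 int_u.
pose A (k : nat) := projT1 (cid (maximal_ergodic_inequality meas_u u0 (ler0n R k) int_u)).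
have AP k := projT2 (cid (maximal_ergodic_inequality meas_u u0 (ler0n R k) int_u)).
have mA k : measurable (A k) by case: (AP k).
exists (\bigcap_k A k); split.
- exact: bigcapT_measurable.
- have ufin : (\int[mu]_x (u x)%:E)%E \is a fin_num.
    by rewrite ge0_fin_numE// integral_ge0// => x _; rewrite lee_fin.
  apply: (@measure_eq0_le_inv _ (fine (\int[mu]_x (u x)%:E)%E)) => [|k].
    exact: bigcapT_measurable.
  rewrite fineK//; case: (AP k) => _ + _; apply: le_trans.
  apply: lee_wpmul2l; first by rewrite lee_fin.
  by apply: le_measure; rewrite ?inE//; [exact: bigcapT_measurable|exact: mA|move=> x Ax; exact: (Ax k)].
- move=> x /= nC k _; apply: contrapT => Akx; apply: nC.
  by exists k%:R; case: (AP k) => _ _; apply.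
Qed.

(** This is how approximation in the mean gives pointwise control: for fixed [l]
    the set where no [u j] has all its averages below [l] has measure at most
    [c * 8^-j / l] for every [j]. *)
Lemma ae_small_averages (u : nat -> T -> R) (c : R) : 0 <= c ->
  (forall j, measurable_fun [set: T] (u j)) -> (forall j x, 0 <= u j x) ->
  (forall j, (\int[mu]_x (u j x)%:E <= (c * 8^-1 ^+ j)%:E)%E) ->
  {ae mu, forall x, forall l : R, 0 < l ->
    exists j, forall k, \sum_(0 <= p < k) u j (iter p tau x) <= k%:R * l}.
Proof.
move=> c0 meas_u u0 iu.
have fu j : (\int[mu]_x (u j x)%:E < +oo)%E by apply: le_lt_trans (iu j) _; exact: ltry.
have l0 i : 0 <= i.+1%:R^-1 :> R by rewrite invr_ge0.
pose P i j := cid (maximal_ergodic_inequality (meas_u j) (u0 j) (l0 i) (fu j)).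
pose A i j := projT1 (P i j).
have mA i j : measurable (A i j) by case: (projT2 (P i j)).
have N0 i : {ae mu, forall x, exists j, ~ A i j x}.
  exists (\bigcap_j A i j); split.
  - exact: bigcapT_measurable.
  - apply: (@measure_eq0_le_inv _ (i.+1%:R * c)) => [|k]; first exact: bigcapT_measurable.
    apply: (@le_trans _ _ (k%:R%:E * mu (A i k))%E).
      apply: lee_wpmul2l; first by rewrite lee_fin.
      apply: le_measure; rewrite ?inE//; first exact: bigcapT_measurable.
      by move=> x Ax; exact: (Ax k).
    have [_ iA _] := projT2 (P i k); have {iA} := le_trans iA (iu k).
    have Afin : mu (A i k) \is a fin_num by exact: fin_num_measure.
    rewrite -/(A i k) -(fineK Afin) -!EFinM !lee_fin; set a := fine _ => ia.
    have a0 : 0 <= a by rewrite fine_ge0.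
    have k8 : k%:R <= 8 ^+ k :> R.
      by rewrite -natrX ler_nat; apply: ltnW; exact: ltn_expl.
    have {}ia : a <= i.+1%:R * (c * 8^-1 ^+ k) by rewrite mulrC -ler_pdivrMr// mulrC.
    apply: le_trans (ler_pM _ _ k8 ia) _ => //.
    by rewrite exprVn mulrCA (mulrCA _ c) divff ?mulr1// expf_neq0.
  - move=> x /= nA j _; apply: contrapT => nAx; apply: nA; by exists j.
have := ae_foralln N0; apply: filterS => x Nx l lpos.
have [i _ il] := near_infty_natSinv_lt (PosNum lpos).
have [j jx] := Nx i; exists j => k; have [_ _ /(_ x jx k)] := projT2 (P i j).
move=> /le_trans; apply; rewrite ler_wpM2l//; apply: ltW; exact: (il i (leqnn i)).
Qed.

End MaximalErgodic.

(** * Almost everywhere convergence from summability *)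

Section Convergence.
Variable R : realType.

Lemma cvg_geometric_increments (x : nat -> R) (C : R) :
  (forall j, (x j.+1 - x j) ^+ 2 <= C * 4^-1 ^+ j) -> cvgn x.
Proof.
move=> xC.
have C0 : 0 <= C by have := xC 0%N; rewrite expr0 mulr1; apply: le_trans; exact: sqr_ge0.
have incr j : `|x j.+1 - x j| <= Num.sqrt C * 2^-1 ^+ j.
  rewrite -sqrtr_sqr -[X in _ * X]ger0_norm ?exprn_ge0// -[X in _ * X]sqrtr_sqr.
  rewrite -sqrtrM//; apply: ler_wsqrtr; apply: le_trans (xC j) _.
  rewrite ler_wpM2l// -exprM mulnC exprM; apply: lerXn2r; rewrite ?nnegrE//.
  by rewrite expr2; lra.
have cs : cvgn (series (telescope x)).
  apply: normed_cvg; apply: (@series_le_cvg _ _ (geometric (Num.sqrt C) 2^-1)).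
  - by move=> j; exact: normr_ge0.
  - by move=> j; rewrite /geometric/= mulr_ge0 ?sqrtr_ge0// exprn_ge0.
  - by move=> j; exact: incr.
  - by apply: is_cvg_geometric_series; rewrite ger0_norm// invf_lt1// ltr1n.
rewrite telescopeK in cs.
have -> : x = [sequence x j - x 0%N]_j + cst (x 0%N).
  by apply/funext => j /=; rewrite !fctE subrK.
by apply: is_cvgD => //; exact: is_cvg_cst.
Qed.

Context d (T : measurableType d) (mu : probability T R).

(** The sum of the [w j] has a finite integral, hence is finite almost
    everywhere, and it bounds each of its terms. *)
Lemma ae_bounded_summable (w : nat -> T -> R) (e : R) : 0 <= e ->
  (forall j, measurable_fun [set: T] (w j)) -> (forall j x, 0 <= w j x) ->
  (forall j, (\int[mu]_x (w j x)%:E <= (e / (2 ^ j.+1)%:R)%:E)%E) ->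
  {ae mu, forall x, exists C : R, forall j, w j x <= C}.
Proof.
move=> e0 mw w0 iw.
pose S x := (\sum_(0 <= j <oo) (w j x)%:E)%E.
have mS : measurable_fun [set: T] S.
  apply: ge0_emeasurable_sum => [j x _ _|j _]; first by rewrite lee_fin.
  exact/measurable_EFinP.
have S0 x : (0 <= S x)%E by apply: nneseries_ge0 => j _ _; rewrite lee_fin.
have intS : mu.-integrable setT S.
  apply/integrableP; split=> //.
  rewrite (@eq_integral _ _ _ _ _ S); last by move=> x _; rewrite gee0_abs.
  rewrite /S integral_nneseries//; last 2 first.
  - by move=> j; exact/measurable_EFinP.
  - by move=> j x _; rewrite lee_fin.
  apply: (@le_lt_trans _ _ e%:E); last exact: ltry.
  apply: le_trans (epsilon_trick0 xpredT e0).
  apply: lee_nneseries => j *; last exact: iw.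
  by apply: integral_ge0 => x _; rewrite lee_fin.
have := integrable_ae measurableT intS; apply: filterS => x /(_ Logic.I) Sx.
exists (fine (S x)) => j; rewrite -lee_fin fineK//.
have := @nneseries_lim_ge R (fun j => (w j x)%:E) xpredT 0%N j.+1.
move=> /(_ (fun _ _ _ => _)) h; apply: le_trans (h _); last by move=> *; rewrite lee_fin.
by rewrite big_nat_recr//= -[leLHS]add0e leeD2r// sume_ge0// => k _; rewrite lee_fin.
Qed.

(** The coordinatewise limit where it exists; the upper limit makes it
    measurable without any discussion of the set of convergence. *)
Definition limit_fun n (v : nat -> T -> 'rV[R]_n) (x : T) : 'rV[R]_n :=
  \row_i fine (limn_esup (fun j => (v j x 0 i)%:E)).

Lemma limit_fun_cvg n (v : nat -> T -> 'rV[R]_n) x :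
  (forall i, cvgn (fun j => v j x 0 i)) ->
  forall i, (fun j => v j x 0 i) @ \oo --> limit_fun v x 0 i.
Proof.
move=> cv i; rewrite mxE.
have cE : (fun j => (v j x 0 i)%:E) @ \oo --> (limn (fun j => v j x 0 i))%:E.
  by apply/cvg_EFin; [exact: nearW|exact: cv].
by rewrite (cvg_limn_einf_sup cE).2 /=; exact: cv.
Qed.

Lemma measurable_limit_fun n (v : nat -> T -> 'rV[R]_n) :
  (forall j i, measurable_fun [set: T] (fun x => v j x 0 i)) ->
  forall i, measurable_fun [set: T] (fun x => limit_fun v x 0 i).
Proof.
move=> mv i; under eq_fun do rewrite mxE.
apply: (measurableT_comp (fine_measurable measurableT)).
by apply: measurable_fun_limn_esup => j; exact/measurable_EFinP.
Qed.

End Convergence.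

(** * Square-integrable vector-valued functions *)

Section L2Space.
Context d (T : measurableType d) (R : realType) (mu : probability T R).
Variables (n : nat) (ip : 'rV[R]_n -> 'rV[R]_n -> R).
Hypotheses (ip_lin : forall v, scalar (ip^~ v)) (ip_sym : forall u v, ip u v = ip v u).
Hypothesis ip_pos : forall u, u != 0 -> 0 < ip u u.
Implicit Types f g h : T -> 'rV[R]_n.

Definition coord_measurable f := forall i, measurable_fun [set: T] (fun x => f x 0 i).

Definition square_integrable f :=
  coord_measurable f /\ (\int[mu]_x (ip (f x) (f x))%:E < +oo)%E.

Definition dot f h : R := \int[mu]_x ip (f x) (h x).

Let ip_norm_ge0 u : 0 <= ip u u. Proof. exact: ip_ge0. Qed.
#[local] Hint Resolve ip_norm_ge0 : core.

Lemma coord_measurable_lin (a b : R) f h : coord_measurable f -> coord_measurable h ->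
  coord_measurable (fun x => a *: f x + b *: h x).
Proof.
move=> mf mh i; under eq_fun do rewrite !mxE.
by apply: measurable_funD; apply: measurable_funM.
Qed.

Lemma measurable_normsq f : coord_measurable f ->
  measurable_fun [set: T] (fun x => (ip (f x) (f x))%:E).
Proof. by move=> mf; apply/measurable_EFinP; exact: measurable_ip. Qed.

Lemma square_integrable_lin (a b : R) f h : square_integrable f -> square_integrable h ->
  square_integrable (fun x => a *: f x + b *: h x).
Proof.
move=> [mf qf] [mh qh]; have mfh := coord_measurable_lin a b mf mh.
split => //; pose A : R := 2 * a ^+ 2; pose B : R := 2 * b ^+ 2.
have A0 : 0 <= A by rewrite mulr_ge0// sqr_ge0.
have B0 : 0 <= B by rewrite mulr_ge0// sqr_ge0.
have mAf : measurable_fun setT (fun x => A%:E * (ip (f x) (f x))%:E)%E.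
  exact: measurable_funeM (measurable_normsq mf).
have mBh : measurable_fun setT (fun x => B%:E * (ip (h x) (h x))%:E)%E.
  exact: measurable_funeM (measurable_normsq mh).
apply: (@le_lt_trans _ _
  (\int[mu]_x (A%:E * (ip (f x) (f x))%:E + B%:E * (ip (h x) (h x))%:E))%E).
  apply: ge0_le_integral => //.
  - by move=> x _; rewrite lee_fin.
  - exact: measurable_normsq.
  - by apply: emeasurable_funD; [exact: mAf|exact: mBh].
  - move=> x _; rewrite -!EFinM -EFinD lee_fin.
    apply: le_trans (ip_normD _ _ _ _ _) _ => //.
    by rewrite !(ipZl ip_lin) !(ipZr ip_lin ip_sym) /A /B; lra.
rewrite ge0_integralD//; last 2 first.
- by move=> x _; rewrite mule_ge0 ?lee_fin.
- by move=> x _; rewrite mule_ge0 ?lee_fin.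
rewrite !ge0_integralZl_EFin//; last 4 first.
- by move=> x _; rewrite lee_fin.
- exact: measurable_normsq.
- by move=> x _; rewrite lee_fin.
- exact: measurable_normsq.
by apply: lte_add_pinfty; apply: lte_mul_pinfty => //; rewrite lee_fin.
Qed.

Lemma integrable_ip f h : square_integrable f -> square_integrable h ->
  mu.-integrable setT (EFin \o (fun x => ip (f x) (h x))).
Proof.
move=> [mf qf] [mh qh].
apply: (@le_integrable _ _ _ _ _ measurableT _
  (fun x => (ip (f x) (f x))%:E + (ip (h x) (h x))%:E)%E).
- by apply/measurable_EFinP; exact: measurable_ip.
- move=> x _; rewrite -EFinD !abse_EFin lee_fin.
  by rewrite [leRHS]ger0_norm ?addr_ge0// ip_le_normsq.
- apply: integrableD => //; apply/integrableP; split; try exact: measurable_normsq.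
    by under eq_integral do rewrite gee0_abs ?lee_fin//.
  by under eq_integral do rewrite gee0_abs ?lee_fin//.
Qed.

Lemma dotE f : square_integrable f -> (dot f f)%:E = (\int[mu]_x (ip (f x) (f x))%:E)%E.
Proof.
move=> [_ qf]; rewrite fineK// ge0_fin_numE//.
by apply: integral_ge0 => x _; rewrite lee_fin.
Qed.

Lemma dot_ge0 f : 0 <= dot f f.
Proof. by apply: Rintegral_ge0 => x _; exact: ip_norm_ge0. Qed.

Lemma dotC f h : dot f h = dot h f.
Proof. by apply: eq_Rintegral => x _; rewrite ip_sym. Qed.

Lemma dot_linl (a b : R) f g h :
  square_integrable f -> square_integrable g -> square_integrable h ->
  dot (fun x => a *: f x + b *: g x) h = a * dot f h + b * dot g h.
Proof.
move=> sf sg sh; have ifh := integrable_ip sf sh; have igh := integrable_ip sg sh.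
rewrite /dot -!RintegralZl// -RintegralD//; last 2 first.
- by have := integrableZl measurableT a ifh; apply: eq_integrable => // x _; rewrite /= EFinM.
- by have := integrableZl measurableT b igh; apply: eq_integrable => // x _; rewrite /= EFinM.
by apply: eq_Rintegral => x _; rewrite (ipDl ip_lin) !(ipZl ip_lin).
Qed.

Lemma dot_ae f g h : square_integrable f -> square_integrable g -> square_integrable h ->
  {ae mu, forall x, f x = g x} -> dot f h = dot g h.
Proof.
move=> sf sg sh fg; congr fine; apply: ae_eq_integral => //.
- by have /integrableP[] := integrable_ip sf sh.
- by have /integrableP[] := integrable_ip sg sh.
by apply: filterS fg => x -> _.
Qed.

Lemma dot_eq0 f : square_integrable f -> dot f f = 0 -> {ae mu, forall x, f x = 0}.
Proof.
move=> sf f0; have := dotE sf; rewrite f0 => /esym f0'.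
have mf := measurable_normsq sf.1.
have := (@ae_eq_integral_abs _ T R mu setT measurableT _ mf).1.
have E : (\int[mu]_x `|(ip (f x) (f x))%:E| = 0)%E.
  by rewrite -[RHS]f0'; apply: eq_integral => x _; rewrite gee0_abs ?lee_fin.
move=> /(_ E); apply: filterS => x /(_ Logic.I) [fx]; exact: (ip_eq0 ip_pos fx).
Qed.

Lemma dot0r f : dot f (fun=> 0) = 0.
Proof. by rewrite /dot; under eq_Rintegral do rewrite ip_sym (ip0l ip_lin); rewrite /Rintegral integral0. Qed.

Lemma square_integrable0 : square_integrable (fun=> 0).
Proof.
split=> [i|]; first by under eq_fun do rewrite mxE; exact: measurable_cst.
by under eq_integral do rewrite (ip0l ip_lin); rewrite integral0.
Qed.

Lemma dot_normsq_lin (a b : R) f h : square_integrable f -> square_integrable h ->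
  dot (fun x => a *: f x + b *: h x) (fun x => a *: f x + b *: h x) =
  a ^+ 2 * dot f f + 2 * (a * b) * dot f h + b ^+ 2 * dot h h.
Proof.
move=> sf sh; have sfh := square_integrable_lin a b sf sh.
set fh := fun x => _ in sfh *.
have linfh g : square_integrable g -> dot g fh = a * dot f g + b * dot h g.
  by move=> sg; rewrite dotC//; exact: dot_linl.
rewrite (linfh _ sfh) (dotC f fh) (dotC h fh).
rewrite !(dotC fh) (linfh _ sf) (linfh _ sh) (dotC h f); ring.
Qed.

Lemma dot_CauchySchwarz f h : square_integrable f -> square_integrable h ->
  dot f h ^+ 2 <= dot f f * dot h h.
Proof.
move=> sf sh; have := dot_ge0 (fun x => dot h h *: f x + - dot f h *: h x).
rewrite dot_normsq_lin// => pos.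
have [h0|hn0] := eqVneq (dot h h) 0.
  suff -> : dot f h = 0 by rewrite expr0n /= mulr_ge0// dot_ge0.
  rewrite dotC -(dot0r f) (dotC f); apply: dot_ae => //; first exact: square_integrable0.
  exact: dot_eq0.
have hpos : 0 < dot h h by rewrite lt0r hn0 dot_ge0.
rewrite -subr_ge0 -(pmulr_rge0 _ hpos); apply: le_trans pos _.
by rewrite le_eqVlt; apply/orP; left; apply/eqP; ring.
Qed.

End L2Space.

(** * Mean and pointwise ergodic theorems for twisted operators *)

Section MeanErgodic.
Context d (T : measurableType d) (R : realType) (mu : probability T R) (tau : T -> T).
Hypothesis mtau : measurable_fun [set: T] tau.
Hypothesis inv : forall A, measurable A -> mu (tau @^-1` A) = mu A.
Variables (n : nat) (ip : 'rV[R]_n -> 'rV[R]_n -> R).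
Hypotheses (ip_lin : forall v, scalar (ip^~ v)) (ip_sym : forall u v, ip u v = ip v u).
Hypothesis ip_pos : forall u, u != 0 -> 0 < ip u u.
Variable U : T -> 'rV[R]_n -> 'rV[R]_n.
Hypotheses (U_lin : forall x, linear (U x)) (U_ip : forall x u v, ip (U x u) (U x v) = ip u v).
Hypothesis mU : forall u i, measurable_fun [set: T] (fun x => U x u 0 i).
Implicit Types f g h : T -> 'rV[R]_n.

Local Notation sqint := (square_integrable mu ip).
Local Notation dot := (dot mu ip).

Let ip_norm_ge0 u : 0 <= ip u u. Proof. exact: ip_ge0. Qed.
#[local] Hint Resolve ip_norm_ge0 : core.

Definition twisted f (x : T) := U x (f (tau x)).
Local Notation W := twisted.

Let U0 x : U x 0 = 0.
Proof. by have := U_lin x (-1) 0 0; rewrite scaler0 addr0 scaleN1r addNr. Qed.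

Let UD x u v : U x (u + v) = U x u + U x v.
Proof. by have := U_lin x 1 u v; rewrite !scale1r. Qed.

Let UZ x a u : U x (a *: u) = a *: U x u.
Proof. by have := U_lin x a u 0; rewrite U0 !addr0. Qed.

Lemma twisted_lin (a b : R) f h x :
  W (fun x => a *: f x + b *: h x) x = a *: W f x + b *: W h x.
Proof. by rewrite /W UD !UZ. Qed.

Lemma U_coord x u i : U x u 0 i = \sum_k u 0 k * U x (delta_mx 0 k) 0 i.
Proof.
rewrite {1}(row_sum_delta u).
have -> : U x (\sum_j u 0 j *: delta_mx 0 j) = \sum_j u 0 j *: U x (delta_mx 0 j).
  by elim/big_rec2: _ => [|j a b _ <-]; rewrite ?U0// UD UZ.
by rewrite summxE; apply: eq_bigr => k _; rewrite mxE.
Qed.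

Lemma coord_measurable_twisted f : coord_measurable f -> coord_measurable (W f).
Proof.
move=> mf i; rewrite /W; under eq_fun do rewrite U_coord.
apply: measurable_sum => k; apply: measurable_funM => //.
exact: (measurableT_comp (mf k) mtau).
Qed.

Lemma sqint_twisted f : sqint f -> sqint (W f).
Proof.
move=> [mf qf]; split; first exact: coord_measurable_twisted.
under eq_integral do rewrite /W U_ip.
rewrite (ge0_integral_invariant mtau inv (u := fun x => ip (f x) (f x)))//.
exact: measurable_ip.
Qed.

Lemma dot_twisted f h : sqint f -> sqint h -> dot (W f) (W h) = dot f h.
Proof.
move=> [mf _] [mh _]; rewrite /dot.
under eq_Rintegral do rewrite /W U_ip.
apply: (Rintegral_invariant mtau inv (u := fun x => ip (f x) (h x))).
exact: measurable_ip.
Qed.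

(** A substitute for the convex hull of the orbit of [f] under [W]: it suffices
    for minimizing the norm, and induction over it needs no bookkeeping of
    coefficients. *)
Inductive hull f : (T -> 'rV[R]_n) -> Prop :=
| hull_base : hull f f
| hull_twisted h : hull f h -> hull f (W h)
| hull_mid h k : hull f h -> hull f k -> hull f (fun x => 2^-1 *: h x + 2^-1 *: k x).

Lemma hull_sqint f h : sqint f -> hull f h -> sqint h.
Proof.
move=> sf; elim=> {h} [//|h _|h k _ sh _ sk]; first exact: sqint_twisted.
exact: (square_integrable_lin ip_lin ip_sym ip_pos).
Qed.

(** Modulo the range of [1 - W], applying [W] changes nothing, and neither does
    averaging. *)
Lemma hull_coboundary f h : sqint f -> hull f h ->
  exists2 g, sqint g & forall x, f x - h x = g x - W g x.
Proof.
move=> sf hh; elim: hh => {h} [|h hh [g sg gE]|h k hh [g sg gE] hk [g' sg' gE']].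
- by exists (fun=> 0) => [|x]; [exact: square_integrable0|rewrite /W U0 !subrr].
- exists (fun x => 1 *: g x + 1 *: h x) => [|x].
    apply: (square_integrable_lin ip_lin ip_sym ip_pos) => //; exact: (hull_sqint sf).
  by rewrite twisted_lin !scale1r opprD addrACA -gE addrA subrK.
- exists (fun x => 2^-1 *: g x + 2^-1 *: g' x) => [|x].
    exact: (square_integrable_lin ip_lin ip_sym ip_pos).
  have half1 : 2^-1 + 2^-1 = 1 :> R by lra.
  rewrite twisted_lin [in RHS]opprD [in RHS]addrACA -!scalerBr -gE -gE'.
  by rewrite !scalerBr addrACA -opprD -scalerDl half1 scale1r.
Qed.

Lemma sub_linE f h : (fun x => 1 *: f x + (-1) *: h x) = (fun x => f x - h x).
Proof. by apply/funext => x; rewrite scale1r scaleN1r. Qed.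

Lemma sqint_sub f h : sqint f -> sqint h -> sqint (fun x => f x - h x).
Proof. by rewrite -sub_linE; exact: (square_integrable_lin ip_lin ip_sym ip_pos). Qed.

Lemma fatou_normsq (v : nat -> T -> 'rV[R]_n) f h (c : R) :
  (forall j, sqint (v j)) -> coord_measurable f -> sqint h ->
  {ae mu, forall x, forall i, (fun j => v j x 0 i) @ \oo --> f x 0 i} ->
  (forall j, dot (fun x => v j x - h x) (fun x => v j x - h x) <= c) ->
  (\int[mu]_x (ip (f x - h x) (f x - h x))%:E <= c%:E)%E.
Proof.
move=> sv mf sh cv vc.
have sub_m g : coord_measurable g -> coord_measurable (fun x => g x - h x).
  by move=> mg; rewrite -sub_linE; apply: coord_measurable_lin => //; case: sh.
pose F j x := (ip (v j x - h x) (v j x - h x))%:E.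
have mF j : measurable_fun setT (F j).
  by apply: (measurable_normsq ip_lin ip_sym); apply: sub_m; case: (sv j).
have F0 j x : setT x -> (0 <= F j x)%E by rewrite lee_fin.
have cF : {ae mu, forall x, F ^~ x @ \oo --> (ip (f x - h x) (f x - h x))%:E}.
  apply: filterS cv => x cvx; apply/cvg_EFin; first exact: nearW.
  rewrite /F /comp /= (ip_coords ip_lin ip_sym).
  under eq_fun do rewrite (ip_coords ip_lin ip_sym).
  have cd i : (fun j => (v j x - h x) 0 i) @ \oo --> (f x - h x) 0 i.
    under eq_fun do rewrite !mxE; rewrite !mxE.
    by apply: cvgB; [exact: cvx|exact: cvg_cst].
  apply: cvg_big => [|i _]; first exact: add_continuous.
  apply: cvg_big => [|k _]; first exact: add_continuous.
  by apply: cvgM; [apply: cvgM; exact: cd|exact: cvg_cst].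
apply: (@le_trans _ _ (\int[mu]_x limn_einf (F ^~ x))%E).
  apply: ae_ge0_le_integral => //.
  - by move=> x _; rewrite lee_fin.
  - by apply: (measurable_normsq ip_lin ip_sym); exact: sub_m.
  - move=> x _; rewrite limn_einf_lim; apply: lime_ge; first exact: is_cvg_einfs.
    by apply: nearW => j; apply: le_ereal_inf_tmp => _ [k _ <-]; exact: F0.
  - have -> : (fun x => limn_einf (F ^~ x)) = (fun x => - limn_esup (fun j => - F j x))%E.
      apply/funext => x; rewrite -limn_einfN; congr limn_einf.
      by apply/funext => j; rewrite /comp oppeK.
    apply: measurableT_comp => //; apply: measurable_fun_limn_esup => j.
    exact: measurableT_comp.
  - by apply: filterS cF => x cx _; rewrite (cvg_limn_einf_sup cx).1.
apply: le_trans (fatou mu measurableT mF F0) _.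
rewrite limn_einf_lim; apply: lime_le; first exact: is_cvg_einfs.
apply: nearW => j; apply: (@le_trans _ _ (\int[mu]_x F j x)%E).
  by apply: ereal_inf_lbound; exists j => /=.
rewrite -dotE//; first by rewrite lee_fin.
exact: sqint_sub.
Qed.

Section Minimizing.
Variable f : T -> 'rV[R]_n.
Hypothesis sf : sqint f.

Let delta := inf [set dot h h | h in hull f].

Let has_inf_delta : has_inf [set dot h h | h in hull f].
Proof.
split; first by exists (dot f f), f => //; exact: hull_base.
by exists 0 => _ [h _ <-]; exact: dot_ge0.
Qed.

Let delta_le h : hull f h -> delta <= dot h h.
Proof. by move=> hh; apply: ge_inf; [case: has_inf_delta|exists h]. Qed.

(** The parallelogram identity: the midpoint of [h] and [k] lies in the hull, so
    its squared norm is at least [delta]. *)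
Lemma hull_close h k e : hull f h -> hull f k ->
  dot h h < delta + e -> dot k k < delta + e ->
  dot (fun x => h x - k x) (fun x => h x - k x) <= 4 * e.
Proof.
rewrite -sub_linE.
move=> hh hk he ke; have := delta_le (hull_mid hh hk).
have sh := hull_sqint sf hh; have sk := hull_sqint sf hk.
rewrite !(dot_normsq_lin ip_lin ip_sym ip_pos)// => *; lra.
Qed.

Lemma minimizing_sequence : exists v : nat -> T -> 'rV[R]_n,
  forall j, hull f (v j) /\ dot (v j) (v j) < delta + 8^-1 ^+ j.
Proof.
have /choice[v vP] : forall j, exists h, hull f h /\ dot h h < delta + 8^-1 ^+ j.
  move=> j; have e0 : 0 < 8^-1 ^+ j :> R by rewrite exprn_gt0// invr_gt0.
  by have [_ [h hh <-] hd] := inf_adherent e0 has_inf_delta; exists h.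
by exists v.
Qed.

Lemma twisted_cvg (v : nat -> T -> 'rV[R]_n) g x :
  (forall i, (fun j => v j (tau x) 0 i) @ \oo --> g (tau x) 0 i) ->
  forall i, (fun j => W (v j) x 0 i) @ \oo --> W g x 0 i.
Proof.
move=> cv i; rewrite /W U_coord; under eq_fun do rewrite U_coord.
apply: cvg_big => [|k _]; first exact: add_continuous.
by apply: cvgM; [exact: cv|exact: cvg_cst].
Qed.

(** Both [v j.+1 - v j] and [v j - W (v j)] are differences of near-minimizers
    ([W] is isometric), of squared norm at most [4 * 8^-j]. Multiplied by [4^j]
    these squares remain summable in the mean, so almost everywhere they are
    [O(4^-j)] and the coordinates form a Cauchy sequence. *)
Lemma ae_cvg_minimizing (v : nat -> T -> 'rV[R]_n) :
  (forall j, hull f (v j) /\ dot (v j) (v j) < delta + 8^-1 ^+ j) ->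
  {ae mu, forall x, forall i, cvgn (fun j => v j x 0 i) /\
    (fun j => (v j x - W (v j) x) 0 i) @ \oo --> (0 : R)}.
Proof.
move=> vP; have sv j : sqint (v j) by apply: (hull_sqint sf); case: (vP j).
have e0 j : 0 < 8^-1 ^+ j :> R by rewrite exprn_gt0// invr_gt0.
have eS j : (8^-1 : R) ^+ j.+1 <= 8^-1 ^+ j.
  by rewrite exprS ler_piMl ?(ltW (e0 _))// invf_le1// ler1n.
pose a j := fun x => v j.+1 x - v j x; pose b j := fun x => v j x - W (v j) x.
have sa j : sqint (a j) by exact: sqint_sub.
have sb j : sqint (b j) by apply: sqint_sub => //; exact: sqint_twisted.
have da j : dot (a j) (a j) <= 4 * 8^-1 ^+ j.
  have [h1 d1] := vP j; have [h2 d2] := vP j.+1.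
  by apply: hull_close => //; apply: lt_le_trans d2 _; rewrite lerD2l.
have db j : dot (b j) (b j) <= 4 * 8^-1 ^+ j.
  have [h1 d1] := vP j; apply: hull_close => //; first exact: hull_twisted.
  by rewrite dot_twisted.
pose w j x := 4 ^+ j * (ip (a j x) (a j x) + ip (b j x) (b j x)).
have w0 j x : 0 <= w j x by rewrite mulr_ge0 ?exprn_ge0// addr_ge0.
have mq h : sqint h -> measurable_fun setT (fun x => ip (h x) (h x)).
  by move=> [mh _]; exact: measurable_ip.
have mw j : measurable_fun setT (w j).
  by apply: measurable_funM => //; apply: measurable_funD; exact: mq.
have iw j : (\int[mu]_x (w j x)%:E <= (16 / (2 ^ j.+1)%:R)%:E)%E.
  under eq_integral do rewrite EFinM.
  rewrite ge0_integralZl_EFin ?exprn_ge0//; last 2 first.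
  - by move=> x _; rewrite lee_fin addr_ge0.
  - by apply/measurable_EFinP; apply: measurable_funD; exact: mq.
  under eq_integral do rewrite EFinD.
  rewrite ge0_integralD//; last 4 first.
  - by move=> x _; rewrite lee_fin.
  - by apply/measurable_EFinP; exact: mq.
  - by move=> x _; rewrite lee_fin.
  - by apply/measurable_EFinP; exact: mq.
  rewrite -!dotE// -EFinD -EFinM lee_fin.
  apply: (@le_trans _ _ (4 ^+ j * (8 * 8^-1 ^+ j))).
    by rewrite ler_wpM2l ?exprn_ge0//; have := da j; have := db j; lra.
  have E : 4 ^+ j * 8^-1 ^+ j = 2^-1 ^+ j :> R by rewrite -exprMn; congr (_ ^+ _); lra.
  by rewrite mulrCA E natrX exprS invfM -exprVn; lra.
have [C C0 ipC] := coord_le_ip ip_lin ip_sym ip_pos.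
have := ae_bounded_summable (ler0n R 16) mw w0 iw.
apply: filterS => x [K wK] i.
have K0 : 0 <= K by apply: le_trans (wK 0%N); exact: w0.
have q4 j : ip (a j x) (a j x) + ip (b j x) (b j x) <= K * 4^-1 ^+ j.
  by rewrite exprVn ler_pdivlMr ?exprn_gt0// mulrC; exact: wK.
have aj j : a j x 0 i ^+ 2 <= (C * K) * 4^-1 ^+ j.
  apply: le_trans (ipC _ _) _; rewrite -mulrA ler_wpM2l//.
  by apply: le_trans (q4 j); rewrite lerDl.
have bj j : b j x 0 i ^+ 2 <= (C * K) * 4^-1 ^+ j.
  apply: le_trans (ipC _ _) _; rewrite -mulrA ler_wpM2l//.
  by apply: le_trans (q4 j); rewrite lerDr.
split; first by apply: (@cvg_geometric_increments _ _ (C * K)) => j; have := aj j; rewrite /a !mxE.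
have sq0 : (fun j => b j x 0 i ^+ 2) @ \oo --> (0 : R).
  have g0 : (fun j => (C * K) * 4^-1 ^+ j) @ \oo --> (0 : R).
    by apply: cvg_geometric; rewrite ger0_norm// invf_lt1// ltr1n.
  by apply: (squeeze_cvgr _ (cvg_cst 0) g0); apply: nearW => j; rewrite sqr_ge0 bj.
have : (fun j => Num.sqrt (b j x 0 i ^+ 2)) @ \oo --> Num.sqrt (0 : R).
  by apply: continuous_cvg => //; exact: sqrt_continuous.
rewrite sqrtr0; under eq_fun do rewrite sqrtr_sqr.
exact: norm_cvg0.
Qed.

(** The mean ergodic theorem, with the decomposition that the pointwise theorem
    needs: up to an error [v - h] small in the mean, [f] is a fixed vector plus a
    coboundary. The fixed vector is the limit of a minimizing sequence of the
    hull, and Fatou's lemma turns the almost everywhere limit into a limit in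
    the mean. *)
Theorem mean_ergodic : exists v : T -> 'rV[R]_n,
  [/\ sqint v, {ae mu, forall x, W v x = v x} &
   forall j : nat, exists h g : T -> 'rV[R]_n,
     [/\ sqint h, sqint g, forall x, f x - h x = g x - W g x &
      (\int[mu]_x (ip (v x - h x) (v x - h x))%:E <= (4 * 8^-1 ^+ j)%:E)%E]].
Proof.
have [u uP] := minimizing_sequence.
have su j : sqint (u j) by apply: (hull_sqint sf); case: (uP j).
have meas_u j i : measurable_fun setT (fun x => u j x 0 i) by case: (su j).
pose v := limit_fun u.
have mv : coord_measurable v := measurable_limit_fun meas_u.
have acv := ae_cvg_minimizing uP.
have cv : {ae mu, forall x, forall i, (fun j => u j x 0 i) @ \oo --> v x 0 i}.
  apply: filterS acv => x ux i; apply: limit_fun_cvg => k; by case: (ux k).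
have vu j : (\int[mu]_x (ip (v x - u j x) (v x - u j x))%:E <= (4 * 8^-1 ^+ j)%:E)%E.
  apply: (@fatou_normsq (fun k => u (k + j)%N)) => //.
    apply: filterS cv => x cx i; have := cx i; by rewrite -(cvg_shiftn j).
  move=> k; have [hj dj] := uP j; have [hk dk] := uP (k + j)%N.
  apply: hull_close => //; apply: lt_le_trans dk _.
  rewrite lerD2l; apply: ler_wiXn2l; rewrite ?invr_ge0 ?invf_le1 ?ler1n ?leq_addl//.
have sv : sqint v.
  have svu : sqint (fun x => v x - u 0%N x).
    split; last by apply: le_lt_trans (vu 0%N) _; exact: ltry.
    by rewrite -sub_linE; exact: coord_measurable_lin.
  have := square_integrable_lin ip_lin ip_sym ip_pos 1 1 svu (su 0%N).
  by congr sqint; apply/funext => x; rewrite !scale1r subrK.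
exists v; split => //.
  have cvt := ae_invariant mtau inv cv.
  apply: filter_app acv; apply: filter_app cvt; apply: filterS cv => x cx ctx ax.
  apply/rowP => i.
  have cW := twisted_cvg ctx (i := i).
  have [_ c0] := ax i.
  have : (fun j => (u j x - W (u j) x) 0 i) @ \oo --> v x 0 i - W v x 0 i.
    under eq_fun do rewrite !mxE.
    by apply: cvgB; [exact: cx|exact: cW].
  by move=> h; apply/esym/subr0_eq; exact: (cvg_unique _ h c0).
move=> j; have [hj _] := uP j; have [g sg gE] := hull_coboundary sf hj.
by exists (u j), g; split.
Qed.

End Minimizing.
Lemma iter_twisted_lin k (a b : R) f h x :
  iter k W (fun x => a *: f x + b *: h x) x = a *: iter k W f x + b *: iter k W h x.
Proof.
elim: k x => // k IH x; rewrite !iterS.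
by rewrite -[RHS]twisted_lin; congr (W _ x); apply/funext => y; exact: IH.
Qed.

Lemma iter_twisted_sub k f h x :
  iter k W (fun x => f x - h x) x = iter k W f x - iter k W h x.
Proof. by rewrite -sub_linE iter_twisted_lin scale1r scaleN1r. Qed.

Lemma ip_iter_twisted k f x :
  ip (iter k W f x) (iter k W f x) = ip (f (iter k tau x)) (f (iter k tau x)).
Proof. by elim: k x => // k IH x; rewrite iterS /W U_ip IH -iterSr. Qed.

Lemma ae_iter_twisted v : {ae mu, forall x, W v x = v x} ->
  {ae mu, forall x, forall k, iter k W v x = v x}.
Proof.
move=> Wv; apply: ae_foralln => k; elim: k => [|k IH]; first exact: aeW.
have := ae_invariant mtau inv IH; apply: filter_app; apply: filterS Wv => x Wx kx.
by rewrite iterS /W kx.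
Qed.

(** Coboundaries telescope, and fixed vectors contribute nothing. *)
Lemma sum_iter_twisted f h g v x N : (forall y, f y - h y = g y - W g y) ->
  (forall k, iter k W v x = v x) ->
  \sum_(0 <= k < N) (iter k W f x - v x) =
  \sum_(0 <= k < N) iter k W (fun y => h y - v y) x + (g x - iter N W g x).
Proof.
move=> fhg vx; elim: N => [|N IH]; first by rewrite !big_geq// add0r subrr.
rewrite !big_nat_recr//= IH iter_twisted_sub vx.
have : iter N W (fun y => f y - h y) x = iter N W (fun y => g y - W g y) x.
  by congr (iter N W _ x); apply/funext => y; exact: fhg.
rewrite !iter_twisted_sub -iterSr iterS => /eqP; rewrite subr_eq => /eqP ->.
set s := \sum_(0 <= k < N) _; set a := iter N W g x; set b := W _ x.
set c := iter N W h x; move: s a b c (g x) (v x) => s a b c e w.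
by apply/rowP => i; rewrite !mxE; ring.
Qed.

(** The hypothesis on [C] is used at [N + 1]: a single term of a sum of
    nonnegative terms is at most the sum, so the two boundary terms of the
    telescoping sum have squared norm at most [(N + 1) * C]. *)
Lemma average_bound f h g v x (l C : R) N : (0 < N)%N ->
  (forall y, f y - h y = g y - W g y) -> (forall k, iter k W v x = v x) ->
  (forall k, \sum_(0 <= p < k) ip (v (iter p tau x) - h (iter p tau x))
                                  (v (iter p tau x) - h (iter p tau x)) <= k%:R * l) ->
  (forall k, \sum_(0 <= p < k) ip (g (iter p tau x)) (g (iter p tau x)) <= k%:R * C) ->
  ip (N%:R^-1 *: \sum_(0 <= k < N) iter k W f x - v x)
     (N%:R^-1 *: \sum_(0 <= k < N) iter k W f x - v x) <= 2 * l + 16 * C / N%:R.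
Proof.
move=> N0 fhg vx hl gC; set D := _ - v x.
have NR0 : 0 < N%:R :> R by rewrite ltr0n.
have DE : D = N%:R^-1 *: \sum_(0 <= k < N) iter k W (fun y => h y - v y) x +
    N%:R^-1 *: (g x - iter N W g x).
  rewrite -scalerDr -(sum_iter_twisted N fhg vx) sumrB scalerBr; congr (_ - _).
  by rewrite sumr_const_nat subn0 -(scaler_nat N (v x)) scalerA mulVf ?scale1r// gt_eqF.
rewrite DE; apply: le_trans (ip_normD ip_lin ip_sym ip_pos _ _) _.
rewrite !(ipZl ip_lin) !(ipZr ip_lin ip_sym); apply: lerD.
  rewrite ler_pM2l// mulrA -invfM -ler_pdivlMl ?invr_gt0 ?mulr_gt0// invrK.
  apply: le_trans (ip_sum_le ip_lin ip_sym ip_pos _ _) _.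
  rewrite -mulrA ler_pM2l//; apply: le_trans (hl N).
  apply: ler_sum => k _; rewrite ip_iter_twisted.
  by rewrite -(ip_normN ip_lin ip_sym (h _ - v _)) opprB.
rewrite -[16]/((2 * 8)%:R) natrM -!mulrA ler_pM2l// mulrA -invfM.
rewrite -ler_pdivlMl ?invr_gt0 ?mulr_gt0// invrK.
apply: le_trans (ip_normB ip_lin ip_sym ip_pos _ _) _.
rewrite ip_iter_twisted.
have g0 p : 0 <= ip (g (iter p tau x)) (g (iter p tau x)) by [].
have gx : ip (g x) (g x) <= N.+1%:R * C.
  apply: le_trans (gC N.+1); rewrite big_nat_recl//= lerDl.
  by apply: sumr_ge0 => p _; exact: (g0 p.+1).
have gN : ip (g (iter N tau x)) (g (iter N tau x)) <= N.+1%:R * C.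
  apply: le_trans (gC N.+1); rewrite big_nat_recr//= lerDr.
  by apply: sumr_ge0 => p _; exact: g0.
have C0 : 0 <= C.
  by have := le_trans (g0 0%N) (le_trans _ (gC 1%N)); rewrite mul1r; apply; rewrite big_nat1.
have N2 : N.+1%:R * C <= 2 * N%:R * C.
  by rewrite ler_wpM2r// -natrM ler_nat mul2n -addnn -addn1 leq_add2l.
have -> : N%:R * N%:R * (8 * (C * N%:R^-1)) = 8 * N%:R * C.
  by field; rewrite gt_eqF.
lra.
Qed.

(** Since [W] is isometric, coboundaries are orthogonal to fixed vectors, so
    [v] is the orthogonal projection of [f]. For the convergence, choose the
    approximation [h j] after the point [x], with [ae_small_averages]; the
    coboundary part is then negligible because the averages of its squared norm
    are bounded along the orbit of [x]. *)
Theorem pointwise_ergodic f : sqint f -> exists v : T -> 'rV[R]_n,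
  [/\ sqint v, {ae mu, forall x, W v x = v x},
   forall h, sqint h -> {ae mu, forall x, W h x = h x} -> dot (fun x => f x - v x) h = 0 &
   {ae mu, forall x, forall i,
     (fun N : nat => (N%:R^-1 *: \sum_(0 <= k < N) iter k W f x - v x) 0 i) @ \oo --> (0 : R)}].
Proof.
move=> sf; have [v [sv Wv approx]] := mean_ergodic sf.
have /choice[h /choice[g hg]] := approx.
have sh j : sqint (h j) by case: (hg j).
have sg j : sqint (g j) by case: (hg j).
have fhg j : forall x, f x - h j x = g j x - W (g j) x by case: (hg j).
have vh j : (\int[mu]_x (ip (v x - h j x) (v x - h j x))%:E <= (4 * 8^-1 ^+ j)%:E)%E.
  by case: (hg j).
have svh j : sqint (fun x => v x - h j x) by exact: sqint_sub.
exists v; split => //.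
- move=> k sk Wk; set r := dot _ k.
  have rE j : r = dot (fun x => 1 *: (fun x => g j x - W (g j) x) x +
      (-1) *: (fun x => v x - h j x) x) k.
    rewrite /r; congr dot; apply/funext => x.
    by rewrite -fhg scale1r scaleN1r opprB addrA subrK.
  have cob j : dot (fun x => g j x - W (g j) x) k = 0.
    have sWg := sqint_twisted (sg j).
    rewrite -sub_linE (dot_linl ip_lin ip_sym ip_pos)//.
    rewrite -(dot_twisted (sg j) sk) (dotC mu ip_sym _ (W k)).
    have -> : dot (W k) (W (g j)) = dot k (W (g j)).
      by apply: (dot_ae ip_lin ip_sym ip_pos) => //; exact: sqint_twisted.
    by rewrite (dotC mu ip_sym k) mul1r mulN1r subrr.
  have r2 j : r ^+ 2 <= 4 * dot k k * 8^-1 ^+ j.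
    rewrite (rE j) (dot_linl ip_lin ip_sym ip_pos)//; last first.
      by apply: sqint_sub => //; exact: sqint_twisted.
    rewrite cob mulr0 add0r mulN1r sqrrN.
    apply: le_trans (dot_CauchySchwarz ip_lin ip_sym ip_pos (svh j) sk) _.
    have := vh j; rewrite -(dotE ip_lin ip_pos (svh j)) lee_fin => dvh.
    by rewrite mulrAC ler_wpM2r// (dot_ge0 mu ip_lin ip_pos).
  apply/eqP; rewrite -sqrf_eq0 eq_le sqr_ge0 andbT.
  have c0 : (fun j => 4 * dot k k * 8^-1 ^+ j) @ \oo --> (0 : R).
    by apply: cvg_geometric; rewrite ger0_norm// invf_lt1// ltr1n.
  by apply: (cvgr_to_ge c0); exact: nearW.
have mq k : sqint k -> measurable_fun setT (fun x => ip (k x) (k x)).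
  by move=> [mk _]; exact: measurable_ip.
have small := ae_small_averages mtau inv (ler0n R 4) (fun j => mq _ (svh j))
  (fun j x => ip_norm_ge0 (v x - h j x)) vh.
have bounded := ae_foralln (fun j => ae_bounded_averages mtau inv (mq _ (sg j))
  (fun x => ip_norm_ge0 (g j x)) (sg j).2).
have Wvk := ae_iter_twisted Wv.
have [K K0 ipK] := coord_le_ip ip_lin ip_sym ip_pos.
apply: filter_app small; apply: filter_app bounded; apply: filterS Wvk => x vx bx sx i.
pose D N := N%:R^-1 *: \sum_(0 <= k < N) iter k W f x - v x.
have D0 : (fun N => ip (D N) (D N)) @ \oo --> (0 : R).
  apply/cvgrPdist_le => e e0.
  have e4 : 0 < e / 4 by rewrite divr_gt0.
  have [j hj] := sx _ e4; have [C gC] := bx j.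
  have cC : (fun N : nat => 16 * C / N%:R) @ \oo --> (0 : R).
    have ch : (fun N : nat => 16 * C * N.+1%:R^-1) @ \oo --> 16 * C * (0 : R).
      by apply: cvgM; [exact: cvg_cst|exact: cvg_harmonic].
    by rewrite -cvg_shiftS; rewrite mulr0 in ch; exact: ch.
  have /cvgrPdist_le/(_ (e / 2)) := cC; rewrite divr_gt0// => /(_ isT) cC'.
  near=> N; rewrite sub0r normrN ger0_norm//.
  apply: le_trans (average_bound _ (fhg j) vx hj gC) _; first by near: N; exists 1%N.
  have : `|0 - 16 * C / N%:R| <= e / 2 by near: N.
  rewrite sub0r normrN => /(le_trans (ler_norm _)) ?; lra.
have sq0 : (fun N => D N 0 i ^+ 2) @ \oo --> (0 : R).
  have K00 : (fun N => K * ip (D N) (D N)) @ \oo --> (0 : R).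
    by rewrite -(mulr0 K); apply: cvgM => //; exact: cvg_cst.
  by apply: (squeeze_cvgr _ (cvg_cst 0) K00); apply: nearW => N; rewrite sqr_ge0 ipK.
have : (fun N => Num.sqrt (D N 0 i ^+ 2)) @ \oo --> Num.sqrt (0 : R).
  by apply: continuous_cvg => //; exact: sqrt_continuous.
rewrite sqrtr0; under eq_fun do rewrite sqrtr_sqr.
exact: norm_cvg0.
Unshelve. all: by end_near. Qed.

End MeanErgodic.

(** * Averages of the cocycle and the orthogonal projection *)

Section Assembly.
Variables (R : realType) (m : nat) (X : ptopologicalType) (sX : smooth_structure R m X).
Variables (mu : probability (borel X) R).
Variables (F : R -> X -> X) (hF : C1_flow sX F).
Hypothesis hmu : forall (t : R) (A : set (borel X)), measurable A ->
    mu (F t @^-1` A) = mu A.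
Variables (n : nat) (G : ptopGroupType) (sG : smooth_structure R n G).
Hypothesis hLie : lie_group sG.
Variables (ip : 'rV[R]_n -> 'rV[R]_n -> R) (hip : Ad_invariant_scalar_product sG ip).
Variables (phi : X -> G).
Hypothesis hphi : measurable_fun [set: borel X] (phi : borel X -> borel G).

Let tau : borel X -> borel X := F 1.
Let U (x : borel X) := Ad sG (phi x).

Lemma flow_measurable : measurable_fun [set: borel X] tau.
Proof.
case: hF => _ _ cF _ _.
apply: (@continuous_borel_measurable X X (F 1)) => x.
have c1 : (fun _ : X => (1 : R)) @ x --> (1 : R) by exact: cvg_cst.
have c2 : (fun y : X => y) @ x --> x by exact: cvg_id.
exact: (cvg_comp _ _ (cvg_pair c1 c2) (cF (1, x))).
Qed.

Lemma flow_iter k x : F k%:R x = iter k (F 1) x.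
Proof.
case: hF => F0 FD _ _ _; elim: k => [|k IH]; first exact: F0.
by rewrite iterS -IH -FD -[k.+1]add1n natrD.
Qed.

Lemma cocycleS k x : cocycle F phi k.+1 x = (phi x * cocycle F phi k (F 1 x))%g.
Proof.
case: hF => F0 FD _ _ _; rewrite /cocycle big_nat_recl//= F0; congr (_ * _)%g.
by apply: eq_bigr => j _; rewrite -FD -natr1.
Qed.

Lemma iter_W_op k f x :
  iter k (twisted tau U) f x = Ad sG (cocycle F phi k x) (f (F k%:R x)).
Proof.
elim: k x => [|k IH] x.
  by rewrite /cocycle big_geq// Ad1; case: hF => ->.
have FS : F k.+1%:R x = F k%:R (F 1 x) by rewrite !flow_iter iterSr.
by rewrite iterS /twisted IH cocycleS (AdM hLie) FS.
Qed.

Let ip_lin : forall v, scalar (ip^~ v). Proof. by case: hip. Qed.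
Let ip_sym : forall u v, ip u v = ip v u. Proof. by case: hip. Qed.
Let ip_pos : forall u, u != 0 -> 0 < ip u u. Proof. by case: hip. Qed.
Let U_lin x : linear (U x). Proof. exact: (Ad_linear hLie). Qed.
Let U_ip x u v : ip (U x u) (U x v) = ip u v.
Proof. by case: hip => _ _ _ ->. Qed.

Let mU u i : measurable_fun [set: borel X] (fun x => U x u 0 i).
Proof. exact: (measurableT_comp (Ad_measurable hLie u i) hphi). Qed.

Lemma L2P f : L2 mu ip f <-> square_integrable mu ip (f : borel X -> _).
Proof.
split=> -[mf qf]; split=> //; last exact: measurable_rV.
by move=> i; exact: (measurableT_comp (continuous_borel_measurable_real (@coord_continuous R 1 n 0 i)) mf).
Qed.

Let erg f (sf : L2 mu ip f) := pointwise_ergodic flow_measurable (hmu 1)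
  ip_lin ip_sym ip_pos U_lin U_ip mU (proj1 (L2P f) sf).

Lemma projection_exists M : in_L2 mu ip M -> is_projection sG mu F phi ip M (P_op sG mu F phi ip M).
Proof.
move=> [f rf]; have [v [sv Wv orth _]] := erg rf.1.
apply: (xgetPex (fun=> 0)).
exists v; split; first by split; [exact/L2P|exact: Wv].
by exists f => // h [/L2P sh Wh]; exact: orth.
Qed.

(** [P_op] is some function with the defining property of the projection of [M],
    for some representative [f] of [M]. The limit [v] of the averages of this
    same [f] has that property too, and the difference [q] is fixed by [W] and
    orthogonal to itself. *)
Lemma averages_cvg_projection M : in_L2 mu ip M ->
  {ae mu, forall x, forall i,
    (fun N : nat => (N%:R^-1 *: \sum_(0 <= k < N) Ad sG (cocycle F phi k x) (M (F k%:R x))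
       - P_op sG mu F phi ip M x) 0 i) @ \oo --> (0 : R)}.
Proof.
move=> /projection_exists; set p := P_op _ _ _ _ _ _ => -[[/L2P sp Wp] [f [sf Mf] orthp]].
have {}Wp : {ae mu, forall x, twisted tau U p x = p x} by exact: Wp.
have {}Mf : {ae mu, forall x, M x = f x} by exact: Mf.
have [v [sv Wv orthv cv]] := erg sf.
have sfs := proj1 (L2P f) sf.
pose q x := p x - v x.
have sq : square_integrable mu ip (q : borel X -> _) by exact: sqint_sub.
have Wq : {ae mu, forall x, twisted tau U q x = q x}.
  apply: filter_app Wv; apply: filterS Wp => x px vx.
  have -> : twisted tau U q x = 1 *: twisted tau U p x + (-1) *: twisted tau U v x.
    by rewrite -(twisted_lin tau U_lin) sub_linE.
  by rewrite px vx scale1r scaleN1r.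
have qq0 : dot mu ip q q = 0.
  have E : q = (fun x => 1 *: (f x - v x) + (-1) *: (f x - p x)).
    by apply/funext => x; rewrite scale1r scaleN1r opprB addrC subrKA.
  rewrite {1}E (dot_linl ip_lin ip_sym ip_pos)//; last 2 first.
  - exact: sqint_sub.
  - exact: sqint_sub.
  rewrite (orthv _ sq Wq).
  have -> : dot mu ip (fun x => f x - p x) q = 0.
    by apply: orthp; split; [exact/L2P|exact: Wq].
  by rewrite !mulr0 addr0.
have q0 := dot_eq0 ip_lin ip_sym ip_pos sq qq0.
have Mk := ae_foralln (fun k => ae_invariant_iter flow_measurable (hmu 1) k Mf).
apply: filter_app cv; apply: filter_app q0; apply: filterS Mk => x Mx qx cx i.
have px : p x = v x by apply/subr0_eq.
rewrite px; under eq_fun do under eq_bigr do rewrite flow_iter Mx -flow_iter -iter_W_op.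
exact: cx.
Qed.

End Assembly.

(** * Transfer to the representation *)

Section LogarithmicDerivative.
Variables (R : realType) (m : nat) (X : ptopologicalType) (sX : smooth_structure R m X).
Variables (F : R -> X -> X) (hF : C1_flow sX F).
Variables (n : nat) (G : ptopGroupType) (sG : smooth_structure R n G).
Hypothesis hLie : lie_group sG.
Variables (phi : X -> G) (d : nat) (pi : G -> 'M[R[i]]_d).
Hypothesis hpi : smooth_unitary_representation sG pi.

Lemma M_pi_phiE x : has_velocity sG (fun t => phi (F t x)) 0 ->
  M_pi_phi F phi pi x = rep_diff sG pi (M_phi sG F phi x).
Proof.
case: hF => F0 _ _ _ _ vx; have := mx_derive_right_translate hLie hpi vx.
by rewrite /M_phi /M_pi_phi !F0.
Qed.

(** Every term of the sum is the image under the real-linear map [rep_diff] of the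
    corresponding term for [Ad], so the representation disappears from the
    convergence problem. *)
Lemma average_W_pi_phiE (N : nat) x p :
  (forall k : nat, has_velocity sG (fun t => phi (F t (F k%:R x))) 0) ->
  (N%:R^-1 : R[i]) *: (\sum_(0 <= k < N) W_pi_phi F phi pi k (M_pi_phi F phi pi) x)
    - rep_diff sG pi p =
  rep_diff sG pi (N%:R^-1 *:
    \sum_(0 <= k < N) Ad sG (cocycle F phi k x) (M_phi sG F phi (F k%:R x)) - p).
Proof.
move=> vx.
have repN u : rep_diff sG pi (- u) = - rep_diff sG pi u.
  by apply/eqP; rewrite -subr_eq0 opprK -(rep_diffD hpi) addNr (rep_diff0 hpi).
rewrite (rep_diffD hpi) repN (rep_diffZ hpi); congr (_ - _).
have -> : (N%:R^-1 : R)%:C%C = N%:R^-1 :> R[i] by rewrite fmorphV rmorph_nat.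
congr (_ *: _); elim/big_rec2: _ => [|k A u _ ->]; first by rewrite (rep_diff0 hpi).
by rewrite (rep_diffD hpi) (rep_diff_Ad hLie hpi) /W_pi_phi M_pi_phiE.
Qed.

End LogarithmicDerivative.

Theorem lemma3p6 (R : realType)
  (m : nat) (X : ptopologicalType) (sX : smooth_structure R m X)
  (hX : compact_manifold_topology X)
  (mu : probability (borel X) R)
  (F : R -> X -> X) (hF : C1_flow sX F)
  (hmu : forall (t : R) (A : set (borel X)), measurable A ->
    mu (F t @^-1` A) = mu A)
  (n : nat) (G : ptopGroupType) (sG : smooth_structure R n G)
  (hG : compact_manifold_topology G) (hLie : lie_group sG)
  (ip : 'rV[R]_n -> 'rV[R]_n -> R) (hip : Ad_invariant_scalar_product sG ip)
  (phi : X -> G)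
  (hphi : measurable_fun [set: borel X] (phi : borel X -> borel G))
  (d : nat) (pi : G -> 'M[R[i]]_d)
  (hpi : smooth_unitary_representation sG pi)
  (hirr : irreducible_representation pi)
  (hder : {ae mu, forall x, has_velocity sG (fun t => phi (F t x)) 0})
  (hM : in_L2 mu ip (M_phi sG F phi)) :
  {ae mu, forall x,
    (fun N : nat =>
       opnorm ((N%:R^-1 : R[i]) *:
                 (\sum_(0 <= k < N) W_pi_phi F phi pi k (M_pi_phi F phi pi) x)
               - rep_diff sG pi (P_op sG mu F phi ip (M_phi sG F phi) x)))
    @ \oo --> (0 : R)}.
Proof.
have mtau := flow_measurable hF.
have vel : {ae mu, forall x : borel X, forall k : nat,
    has_velocity sG (fun t => phi (F t (F k%:R x))) 0}.
  apply: ae_foralln => k.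
  have vk : {ae mu, forall x : borel X, has_velocity sG (fun t => phi (F t (iter k (F 1) x))) 0}.
    exact: (ae_invariant_iter mtau (hmu 1) k hder).
  by apply: filterS vk => x; rewrite (flow_iter hF).
have av := averages_cvg_projection hF hmu hLie hip hphi hM.
apply: (@filterS2 _ (almost_everywhere mu) _ _ _ _ _ vel av) => x vx cx.
under eq_fun do rewrite (average_W_pi_phiE hF hLie hpi) //.
exact: (opnorm_rep_diff_cvg0 hpi cx).
Qed.
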